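(* Let $\Phi:\mathbb{N}\times(0,\infty)\to[0,\infty)$ be a function such that $\Phi(n,\varepsilon)$ is increasing in $n$, decreasing in $\varepsilon$, and subadditive (i.e. $\Phi(k+m,\varepsilon)\le\Phi(k,\varepsilon)+\Phi(m,\varepsilon)$ for all $\varepsilon>0$ and $k,m\in\mathbb{N}$). Then there exists a measure-preserving system $(X,\mu,T)$ such that $$\Phi\in\mathcal{H}(X,\mu,T),$$ where $\mathcal{H}(X,\mu,T)$ is the scaling entropy of the system.
   Context: A measure-preserving system $(X,\mu,T)$ is a standard probability space $(X,\mu)$ with an invertible measure-preserving transformation $T$. Increasing and decreasing are meant in the non-strict sense; $\mathbb{N}=\{1,2,\dots\}$. A measurable semimetric on $(X,\mu)$ is a symmetric non-negative measurable function $\rho$ on $(X^2,\mu^2)$ satisfying the triangle inequality. $\varepsilon$-entropy: for $\varepsilon>0$, let $k$ be the minimal positive integer such that $X$ decomposes into a union of measurable sets $X_0,X_1,\dots,X_k$ with $\mu(X_0)<\varepsilon$ and $\operatorname{diam}_\rho(X_i)<\varepsilon$ for all $i>0$; put $\mathbb{H}_\varepsilon(X,\mu,\rho)=\log_2 k$, and $\mathbb{H}_\varepsilon(X,\mu,\rho)=+\infty$ if no such $k$ exists. A semimetric $\rho$ is admissible if $\mathbb{H}_\varepsilon(X,\mu,\rho)<+\infty$ for all $\varepsilon>0$. Averaged semimetric: $T_{av}^n\rho(x,y)=\frac1n\sum_{k=0}^{n-1}\rho(T^kx,T^ky)$. A semimetric $\rho$ is generating (for $T$) if there is a set $X'\subset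 X$ of full measure such that for any distinct $x,y\in X'$ there is $n\in\mathbb{N}$ with $T_{av}^n\rho(x,y)>0$. For sequences $\phi,\psi$ of non-negative reals, $\phi\lesssim\psi$ means there is $C>0$ with $\phi(n)\le C\psi(n)$ for all $n\in\mathbb{N}$. For functions $\Phi,\Psi:\mathbb{N}\times(0,\infty)\to[0,\infty)$ decreasing in their second argument, write $\Phi\preceq\Psi$ if for every $\varepsilon>0$ there is $\delta>0$ such that $\Phi(n,\varepsilon)\lesssim\Psi(n,\delta)$ (as sequences in $n$), and $\Phi\sim\Psi$ if $\Phi\preceq\Psi$ and $\Psi\preceq\Phi$; $[\Phi]$ denotes the equivalence class of $\Phi$ under $\sim$. The scaling entropy of $(X,\mu,T)$ is the class $\mathcal{H}(X,\mu,T)=[\,(n,\varepsilon)\mapsto\mathbb{H}_\varepsilon(X,\mu,T_{av}^n\rho)\,]$, where $\rho$ is any admissible generating semimetric with finite integral over $(X^2,\mu^2)$; this class does not depend on the choice of $\rho$. *)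

(* Defs.v *)
(* MathComp-Analysis. *)
From HB Require Import structures.
From mathcomp Require Import all_boot all_order all_algebra.
From mathcomp Require Import all_classical all_reals all_analysis.

Set Implicit Arguments.
Unset Strict Implicit.
Unset Printing Implicit Defensive.

Import Order.TTheory GRing.Theory Num.Theory.
Import numFieldNormedType.Exports.

Local Open Scope classical_set_scope.
Local Open Scope ring_scope.

(* A Polish space is a complete separable metrizable one: for a pseudometric
   space, metrizable means Hausdorff and separable means second countable.
   X is standard Borel when a bijection onto such a space identifies its
   sigma-algebra with the Borel one. *)
Definition standard_borel (R : realType) (d : measure_display)
    (X : measurableType d) : Prop :=
  exists (P : completePseudoMetricType R) (f : X -> P),
    [/\ hausdorff_space P,
        @second_countable P,
        bijective f
      & forall A : set X, measurable A <-> <<s @open P >> (f @` A)].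

Definition invertible_measure_preserving (R : realType) (d : measure_display)
    (X : measurableType d) (mu : probability X R) (T : X -> X) : Prop :=
  [/\ measurable_fun setT T,
      exists T' : X -> X,
        [/\ cancel T T', cancel T' T & measurable_fun setT T']
    & forall A : set X, measurable A -> mu (T @^-1` A) = mu A].

Definition measure_preserving_system (R : realType) (d : measure_display)
    (X : measurableType d) (mu : probability X R) (T : X -> X) : Prop :=
  standard_borel R X /\ invertible_measure_preserving mu T.

(* rho x x = 0 is not required; for an admissible rho it holds for almost
   every x. *)
Definition measurable_semimetric (R : realType) (d : measure_display)
    (X : measurableType d) (rho : X -> X -> R) : Prop :=
  [/\ forall x y, rho x y = rho y x,
      forall x y, 0 <= rho x y,
      measurable_fun setT (fun p : X * X => rho p.1 p.2)
    & forall x y z, rho x z <= rho x y + rho y z].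

(* diam rho set0 is -oo instead of the usual 0; both are below every
   positive real. *)
Definition diam (R : realType) (X : Type) (rho : X -> X -> R) (A : set X)
    : \bar R :=
  ereal_sup [set (rho p.1 p.2)%:E | p in A `*` A].

Definition eps_decomposition (R : realType) (d : measure_display)
    (X : measurableType d) (mu : probability X R) (rho : X -> X -> R)
    (eps : R) (k : nat) : Prop :=
  exists F : 'I_k.+1 -> set X,
    [/\ forall i, measurable (F i),
        \bigcup_i F i = setT,
        (mu (F ord0) < eps%:E)%E
      & forall i, i != ord0 -> (diam rho (F i) < eps%:E)%E].

Definition eps_entropy (R : realType) (d : measure_display)
    (X : measurableType d) (mu : probability X R) (rho : X -> X -> R)
    (eps : R) : \bar R :=
  match pselect (exists k : nat,
      `[< (0 < k)%N /\ eps_decomposition mu rho eps k >]) with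
  | left kP => (ln (ex_minn kP)%:R / ln 2)%:E
  | right _ => +oo%E
  end.

Definition admissible (R : realType) (d : measure_display)
    (X : measurableType d) (mu : probability X R) (rho : X -> X -> R) : Prop :=
  forall eps : R, 0 < eps -> (eps_entropy mu rho eps < +oo)%E.

Definition averaged (R : realType) (X : Type) (T : X -> X)
    (rho : X -> X -> R) (n : nat) : X -> X -> R :=
  fun x y => n%:R^-1 * \sum_(k < n) rho (iter k T x) (iter k T y).

Definition generating (R : realType) (d : measure_display)
    (X : measurableType d) (mu : probability X R) (T : X -> X)
    (rho : X -> X -> R) : Prop :=
  exists X' : set X, mu.-negligible (~` X') /\
    forall x y, X' x -> X' y -> x <> y ->
      exists2 n : nat, (0 < n)%N & 0 < averaged T rho n x y.

(* Functions N x (0,oo) -> [0,oo] are total functions whose values at n = 0 or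
   eps <= 0 are irrelevant. The value +oo is allowed because eps_entropy is
   extended-real valued. *)
Definition seq_lesssim (R : realType) (phi psi : nat -> \bar R) : Prop :=
  exists2 C : R, 0 < C &
    forall n : nat, (0 < n)%N -> (phi n <= C%:E * psi n)%E.

Definition entropy_le (R : realType) (Phi Psi : nat -> R -> \bar R) : Prop :=
  forall eps : R, 0 < eps -> exists2 delta : R, 0 < delta &
    seq_lesssim (fun n => Phi n eps) (fun n => Psi n delta).

Definition entropy_equiv (R : realType) (Phi Psi : nat -> R -> \bar R) : Prop :=
  entropy_le Phi Psi /\ entropy_le Psi Phi.

Definition nonneg_fun (R : realType) (Phi : nat -> R -> R) : Prop :=
  forall (n : nat) (eps : R), (0 < n)%N -> 0 < eps -> 0 <= Phi n eps.

Definition decreasing_eps (R : realType) (Phi : nat -> R -> R) : Prop :=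
  forall (n : nat) (eps delta : R), (0 < n)%N -> 0 < eps -> eps <= delta ->
    Phi n delta <= Phi n eps.

Definition increasing_n (R : realType) (Phi : nat -> R -> R) : Prop :=
  forall (m n : nat) (eps : R), (0 < m)%N -> (m <= n)%N -> 0 < eps ->
    Phi m eps <= Phi n eps.

Definition subadditive_n (R : realType) (Phi : nat -> R -> R) : Prop :=
  forall (k m : nat) (eps : R), (0 < k)%N -> (0 < m)%N -> 0 < eps ->
    Phi (k + m)%N eps <= Phi k eps + Phi m eps.

Definition admissible_generating_integrable (R : realType)
    (d : measure_display) (X : measurableType d) (mu : probability X R)
    (T : X -> X) (rho : X -> X -> R) : Prop :=
  [/\ measurable_semimetric rho,
      admissible mu rho,
      generating mu T rho
    & (\int[mu \x mu]_p (rho p.1 p.2)%:E < +oo)%E].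

(* The equivalence class is the same for every representative rho, so
   membership means equivalence with the entropies of some rho. *)
Definition scaling_entropy (R : realType) (d : measure_display)
    (X : measurableType d) (mu : probability X R) (T : X -> X)
    : set (nat -> R -> R) :=
  [set Phi | [/\ nonneg_fun Phi, decreasing_eps Phi
    & exists2 rho : X -> X -> R, admissible_generating_integrable mu T rho &
        entropy_equiv (fun n eps => (Phi n eps)%:E)
          (fun n eps => eps_entropy mu (averaged T rho n) eps)]].

(* Main.v *)
From HB Require Import structures.
From Stdlib Require PeanoNat.
Require Import Defs.
From mathcomp Require Import all_boot all_order all_algebra.
From mathcomp Require Import all_classical all_reals all_analysis.
From mathcomp Require Import measurable_realfun.
From mathcomp Require Import zify ring lra.

(* Fix scales eps_j -> 0.  Since Phi(., eps_j) is increasing and at most doubles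
   from 2^N to 2^(N+1), there is a set S_j of digit positions such that
   2^|S_j n [0,N)| is Phi(2^N, eps_j) up to constants.  The system is an
   extension of the dyadic odometer a |-> a + 1: above a sit independent random
   functions z_j from finite sets of digit positions to bits, and when a is
   incremented z_j is translated, for the symmetric difference, by the set of
   those changed digits which lie in S_j.  During a window of length 2^N the bit
   z_j(0) reads the values of z_j at essentially all subsets of S_j n [0,N),
   each of them equally often.

   Lower bound: flipping these values along the words of a code with linear rate
   and distance moves a set of small diameter to pairwise disjoint sets of the
   same measure.  Upper bound: up to a small proportion of the times of the
   window, the orbit is determined by these values (before and after the only
   carry out of the first N digits) together with the leading digits of
   a mod 2^i for i in S_j; about |S_j n [0,i)| leading digits are enough for each
   i, which is negligible against 2^|S_j n [0,N)|. *)

Set Implicit Arguments.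
Unset Strict Implicit.
Unset Printing Implicit Defensive.

Import Order.TTheory GRing.Theory Num.Theory.
Import numFieldNormedType.Exports.

(** * Binary digits and a code *)

Section binary.
Local Open Scope nat_scope.

Definition bit (k m : nat) : bool := odd (m %/ 2 ^ k).

Lemma bit_small k m : m < 2 ^ k -> bit k m = false.
Proof. by move=> mk; rewrite /bit divn_small. Qed.

Lemma bit_addX k m : m < 2 ^ k -> bit k (m + 2 ^ k) = true.
Proof.
by move=> mk; rewrite /bit addnC -{1}[2 ^ k]mul1n divnMDl ?expn_gt0// divn_small.
Qed.

Lemma bit_addMX k j m n : k < j -> bit k (m + n * 2 ^ j) = bit k m.
Proof.
move=> kj; rewrite /bit -(subnKC kj) addSn expnS expnD addnC.
have -> : n * (2 * (2 ^ k * 2 ^ (j - k.+1))) = 2 * (n * 2 ^ (j - k.+1)) * 2 ^ k by lia.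
by rewrite divnMDl ?expn_gt0// oddD oddM.
Qed.

Lemma bit_modX k j m : k < j -> bit k (m %% 2 ^ j) = bit k m.
Proof.
by move=> kj; rewrite [in RHS](divn_eq m (2 ^ j)) addnC bit_addMX.
Qed.

(** Splitting off the top digit gives two copies of the previous range; a constraint at that
    position keeps exactly one. This counts dyadic intervals in [coin_cyl] and visits to a pattern
    in [sum_restrict]. *)
Lemma sum_bits_eq (S : pred nat) (b : nat -> bool) K :
  \sum_(0 <= m < 2 ^ K) all (fun k => S k ==> (bit k m == b k)) (iota 0 K) =
  2 ^ count (predC S) (iota 0 K).
Proof.
elim: K => [|K IH]; first by rewrite expn0 big_nat1.
have iotaS : iota 0 K.+1 = rcons (iota 0 K) K by rewrite -addn1 iotaD cats1.
rewrite iotaS -cats1 count_cat /= addn0 expnS mul2n -addnn.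
rewrite (big_cat_nat (n := 2 ^ K)) ?leq_addr//=.
rewrite -{2}[2 ^ K]add0n big_addn addnK.
rewrite (eq_big_nat _ _
  (F2 := fun m => (S K ==> ~~ b K) * all (fun k => S k ==> (bit k m == b k)) (iota 0 K))).
  rewrite [X in _ + X](eq_big_nat _ _
  (F2 := fun m => (S K ==> b K) * all (fun k => S k ==> (bit k m == b k)) (iota 0 K))).
    rewrite -!big_distrr /= IH -mulnDl addnC expnD mulnC; congr muln.
    by case: (S K) (b K) => -[].
  move=> m /andP[_ mK]; rewrite all_cat /= andbT bit_addX// andbC mulnb.
  congr nat_of_bool; congr andb.
  apply: eq_in_all => k; rewrite mem_iota add0n => /andP[_ kK].
  by rewrite -[X in m + X]mul1n bit_addMX.
move=> m /andP[_ mK]; rewrite all_cat /= andbT bit_small// andbC mulnb.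
by case: (b K).
Qed.

Lemma sum_mod_shift (F : nat -> nat) M A : 0 < M ->
  \sum_(0 <= t < M) F ((A + t) %% M) = \sum_(0 <= t < M) F t.
Proof.
move=> M0; elim: A => [|A IH].
  by apply: eq_big_nat => t /andP[_ tM]; rewrite add0n modn_small.
rewrite -{}IH; case: M M0 => // M _; rewrite big_nat_recr//= [RHS]big_nat_recl//.
rewrite addnC addn0 addSnnS -modnDmr modnn addn0; congr addn.
by apply: eq_bigr => t _; rewrite addSnnS.
Qed.

Lemma sum_mod (F : nat -> nat) M q :
  \sum_(0 <= t < q * M) F (t %% M) = q * \sum_(0 <= t < M) F t.
Proof.
elim: q => [|q IH]; first by rewrite !mul0n big_geq.
rewrite !mulSn addnC (big_cat_nat (n := q * M)) ?leq_addr//= {}IH addnC.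
congr addn; rewrite -{1}[q * M]add0n big_addn addKn.
by apply: eq_big_nat => t /andP[_ tM]; rewrite addnC modnMDl modn_small.
Qed.

Definition carry i A t := 2 ^ i <= A %% 2 ^ i + t %% 2 ^ i.

Lemma bit_add i A t : bit i (A + t) = bit i A (+) bit i t (+) carry i A t.
Proof. by rewrite /bit divnD ?expn_gt0// !oddD /carry; case: (_ <= _). Qed.

Lemma sum_itv_le a b M : \sum_(0 <= s < M) ((a <= s) && (s < b)) <= b - a.
Proof.
elim: M => [|M IH]; first by rewrite big_geq.
have [aM|Ma] := leqP a M; last first.
  rewrite big_nat big1 // => s /andP[_ sM].
  by have -> : (a <= s) = false by lia.
rewrite big_nat_recr//=.
have [Mb|bM] := ltnP M b; last by rewrite andbF addn0.
rewrite aM /=; have h : forall K, K <= b -> a <= K ->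
   \sum_(0 <= s < K) ((a <= s) && (s < b)) <= K - a.
  elim => [|K IHK] Kb aK; first by rewrite big_geq.
  rewrite big_nat_recr//=; have [aK'|] := leqP a K.
    by rewrite Kb; have := IHK (ltnW Kb) aK'; lia.
  move=> Ka; rewrite addn0 big_nat big1 // => s /andP[_ sK].
  by have -> : (a <= s) = false by lia.
by have := h M (ltnW Mb) aM; lia.
Qed.

(** Residues with the same [c] leading digits differ by less than [2 ^ (i - c)], and the carries
    differ only when [t] modulo [2 ^ i] lies in an interval of that length: a proportion at most
    [2 ^ -c] of the times. *)
Lemma sum_carry_neq i c N A A' : i <= N ->
  A %% 2 ^ i %/ 2 ^ (i - c) = A' %% 2 ^ i %/ 2 ^ (i - c) ->
  2 ^ c * \sum_(0 <= t < 2 ^ N) (carry i A t != carry i A' t) <= 2 ^ N.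
Proof.
move=> iN; set r := A %% _; set r' := A' %% _ => rr'.
(* For [i < c] the truncated difference [i - c] is 0, so the residues themselves agree. *)
have [ic|ci] := ltnP i c.
  move: rr'; have -> : i - c = 0 by lia.
  rewrite expn0 !divn1 => rr'.
  rewrite big1 ?muln0 // => t _; rewrite /carry -/r -/r' rr'.
  by case: eqP.
have drr' : r - r' < 2 ^ (i - c) /\ r' - r < 2 ^ (i - c).
  have := divn_eq r (2 ^ (i - c)); have := divn_eq r' (2 ^ (i - c)).
  have := ltn_pmod r (expn_gt0 2 (i - c)); have := ltn_pmod r' (expn_gt0 2 (i - c)).
  rewrite rr'; clearbody r r'; clear; lia.
rewrite -(subnK iN) expnD.
rewrite (sum_mod (fun s => (2 ^ i <= r + s) != (2 ^ i <= r' + s)))/=.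
rewrite mulnCA leq_mul2l; apply/orP; right.
have -> : forall m, (2 ^ c * m <= 2 ^ i) = (m <= 2 ^ (i - c)).
  by move=> m; rewrite -{1}(subnKC ci) expnD leq_pmul2l ?expn_gt0.
have ri : r < 2 ^ i by rewrite ltn_pmod ?expn_gt0.
have r'i : r' < 2 ^ i by rewrite ltn_pmod ?expn_gt0.
move: (2 ^ i) (2 ^ (i - c)) drr' ri r'i => M d [drr' dr'r] ri r'i.
clearbody r r'; clear rr' iN ci A A'.
apply: leq_trans (_ : (M - minn r r') - (M - maxn r r') <= _); last first.
  case: (leqP r r') => rr'; lia.
apply: leq_trans (sum_itv_le _ _ M).
apply: leq_sum => s _.
case: (leqP r r') => rr';
  case: (leqP M (r + s)) => ?; case: (leqP M (r' + s)) => //= ?;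
  rewrite lt0b; apply/andP; split; lia.
Qed.

Section code.
Variable T : finType.
Implicit Types v w : {ffun T -> bool}.

Definition hamming v w := \sum_t (v t != w t).

Let p := #|T|.

Lemma card_ball_le r v :
  #|[set w | hamming v w <= r]| * 4 ^ p <= 5 ^ p * 4 ^ r.
Proof.
(* Weighting each letter by 4 or 1 makes the total weight 5 ^ p. *)
have E : \sum_(w : {ffun T -> bool}) 4 ^ (p - hamming v w) = 5 ^ p.
  transitivity (\sum_(w : {ffun T -> bool}) \prod_t (if v t == w t then 4 else 1)).
    apply: eq_bigr => w _; rewrite -big_mkcond /= prod_nat_const; congr (_ ^ _).
    rewrite /p -(cardC (fun t => v t == w t)); apply/eqP.
    rewrite -(eqn_add2r (hamming v w)) subnK; last first.
      by rewrite cardC /hamming -sum1_card; apply: leq_sum => t _; case: eqP.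
    rewrite eqn_add2l /hamming -sum1_card [X in X == _]big_mkcond; apply/eqP.
    by under eq_bigr do rewrite -topredE /=.
  transitivity (\prod_t \sum_(b : bool) (if v t == b then 4 else 1)).
    by rewrite bigA_distr_bigA.
  rewrite (eq_bigr (fun=> 5)) ?prod_nat_const// => t _.
  by rewrite big_bool /=; case: (v t).
(* A word within distance [r] has weight at least [4 ^ (p - r)]. *)
rewrite -E -sum_nat_const big_distrl /= big_mkcond /=.
apply: leq_sum => w _; rewrite inE; case: ifP => // vw.
by rewrite -expnD leq_exp2l//; lia.
Qed.

(* Gilbert-Varshamov: the balls around a maximal code cover the space. *)
Lemma exists_code : exists C : {set {ffun T -> bool}},
  2 ^ p <= #|C| ^ 4 /\
  {in C &, forall v w, v != w -> p < 8 * hamming v w}.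
Proof.
pose sep (C : {set {ffun T -> bool}}) :=
  [forall v in C, forall w in C, (v != w) ==> (p < 8 * hamming v w)].
have sep0 : sep finset.set0 by apply/forall_inP => v; rewrite inE.
have [C /maxsetP[Csep Cmax] _] := maxset_exists sep0.
exists C; split; last first.
  by move=> v w vC wC vw; have /forall_inP/(_ v vC)/forall_inP/(_ w wC) := Csep; rewrite vw.
pose r := p %/ 8.
have hC v w : hamming v w = hamming w v.
  by apply: eq_bigr => t _; rewrite eq_sym.
have hr v w : (hamming v w <= r) = ~~ (p < 8 * hamming v w).
  by rewrite -leqNgt leq_divRL// mulnC.
have cov w : exists2 v, v \in C & hamming v w <= r.
  have [wC|wC] := boolP (w \in C).
    by exists w => //; rewrite /hamming big1// => t _; rewrite eqxx.
  apply/exists_inP; apply: contraNT wC; rewrite negb_exists => /forallP h.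
  have Uw : sep (w |: C).
    have hw v : v \in C -> p < 8 * hamming v w.
      by move=> vC; have := h v; rewrite vC /= hr negbK.
    apply/forall_inP => a; rewrite !inE => /predU1P[->|aC];
      apply/forall_inP => b; rewrite !inE => /predU1P[->|bC].
    - by rewrite eqxx.
    - by rewrite hC hw ?implybT.
    - by rewrite hw ?implybT.
    - by have /forall_inP/(_ a aC)/forall_inP/(_ b bC) := Csep.
  by rewrite -(Cmax _ Uw (finset.subsetU1 _ _)) finset.setU11.
have tot : 2 ^ p <= \sum_(v in C) #|[set w | hamming v w <= r]|.
  have -> : 2 ^ p = \sum_(w : {ffun T -> bool}) 1.
    by rewrite sum1_card card_ffun card_bool.
  under eq_bigr do rewrite -sum1_card big_mkcond.
  rewrite exchange_big /=; apply: leq_sum => w _.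
  by have [v vC vw] := cov w; rewrite (bigD1 v)//= inE vw.
(* In fourth powers this reads [4096 ^ p <= #|C| ^ 4 * 625 ^ p * 4 ^ (4 * r)], and
   [4 ^ (4 * r) <= 2 ^ p] because [r <= p / 8]. Since 4096 exceeds 2 * 1250, the claim follows. *)
have : 2 ^ p * 4 ^ p <= #|C| * (5 ^ p * 4 ^ r).
  apply: leq_trans (_ : \sum_(v in C) #|[set w | hamming v w <= r]| * 4 ^ p <= _).
    by rewrite -big_distrl /= leq_mul2r tot orbT.
  by rewrite -sum_nat_const; apply: leq_sum => v _; exact: card_ball_le.
rewrite -(@leq_exp2r _ _ 4)// !expnMn -!expnM !(mulnC p 4) ![_ ^ (4 * p)]expnM.
have : (4 ^ (r * 4)) <= 2 ^ p.
  by rewrite -[4]/(2 ^ 2) -expnM leq_exp2l//; rewrite /r; lia.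
move=> h1; rewrite -(expnMn (2 ^ 4) (4 ^ 4)) -expnM => h2.
have {h2} : (2 * (5 ^ 4 * 2)) ^ p <= #|C| ^ 4 * (5 ^ 4 * 2) ^ p.
  rewrite (expnMn (5 ^ 4)); apply: leq_trans (leq_trans h2 _).
    by case: (posnP p) => [->//|p0]; rewrite leq_exp2r.
  by rewrite -expnM leq_mul2l leq_mul2l h1 !orbT.
by rewrite expnMn leq_pmul2r// expn_gt0.
Qed.
End code.

End binary.

Local Open Scope classical_set_scope.
Local Open Scope ring_scope.

(** * The Cantor space *)

(* R only records the field in which the metric on bits takes its values. *)
Definition bits (R : realType) (I : countType) : Type := I -> bool.

HB.instance Definition _ (R : realType) (I : countType) :=
  Choice.copy (bits R I) (I -> bool).
HB.instance Definition _ (R : realType) (I : countType) :=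
  isPointed.Build (bits R I) (fun=> false).

Section bits_metric.
Variables (R : realType) (I : countType).
Implicit Types (x y z : I -> bool) (i : I) (e : R).

Definition weight i : R := 2^-1 ^+ pickle i.

Lemma weight_gt0 i : 0 < weight i.
Proof. by rewrite exprn_gt0. Qed.

Lemma weight_le1 i : weight i <= 1.
Proof. by rewrite exprn_ile1 ?invf_le1 ?ler1n. Qed.

(** An ultrametric for the product topology; the value 0 keeps the set non-empty when [x = y]. *)
Definition first_diff x y : R :=
  sup [set w | w = 0 \/ exists2 i, x i <> y i & w = weight i].

Let D x y : set R := [set w | w = 0 \/ exists2 i, x i <> y i & w = weight i].

Let D_sup x y : has_sup (D x y).
Proof.
split; first by exists 0; left.
by exists 1 => w [->|[i _ ->]]; rewrite ?ler01 ?weight_le1.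
Qed.

Lemma first_diff_ge0 x y : 0 <= first_diff x y.
Proof. by apply: (@sup_upper_bound _ (D x y)) => //; left. Qed.

Lemma weight_le_first_diff x y i : x i <> y i -> weight i <= first_diff x y.
Proof.
by move=> xyi; apply: (@sup_upper_bound _ (D x y)) => //; right; exists i.
Qed.

Lemma first_diff_le x y e :
  0 <= e -> (forall i, e < weight i -> x i = y i) -> first_diff x y <= e.
Proof.
move=> e0 xy; apply: ge_sup; first by exists 0; left.
move=> w [->//|[i xyi ->]]; rewrite leNgt; apply/negP => /xy//.
Qed.

Lemma first_diff_leP x y e :
  0 <= e -> (first_diff x y <= e <-> forall i, e < weight i -> x i = y i).
Proof.
move=> e0; split => [xye i wi|]; last exact: first_diff_le.
apply: contrapT => /weight_le_first_diff /(lt_le_trans wi).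
by rewrite ltNge xye.
Qed.

Lemma first_diff_le1 x y : first_diff x y <= 1.
Proof. by apply: first_diff_le => // i; rewrite ltNge weight_le1. Qed.

Lemma first_diffxx x : first_diff x x = 0.
Proof.
by apply/eqP; rewrite eq_le first_diff_ge0 andbT; apply: first_diff_le.
Qed.

Lemma first_diff_eq0 x y : first_diff x y = 0 -> x = y.
Proof.
move=> /eqP; rewrite eq_le => /andP[/first_diff_leP xy _].
by apply/funext => i; apply: xy => //; exact: weight_gt0.
Qed.

Lemma first_diffC x y : first_diff x y = first_diff y x.
Proof.
congr sup; apply/seteqP; split => w [->|[i xy ->]]; (try by left);
  by right; exists i => // /esym.
Qed.

Lemma first_diff_triangle y x z :
  first_diff x z <= first_diff x y + first_diff y z.
Proof.
apply: first_diff_le => [|i wi]; first by rewrite addr_ge0 ?first_diff_ge0.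
rewrite ((first_diff_leP x y (first_diff_ge0 x y)).1 (lexx _) i).
  apply: (first_diff_leP y z (first_diff_ge0 y z)).1 => //.
  by apply: le_lt_trans wi; rewrite lerDr first_diff_ge0.
by apply: le_lt_trans wi; rewrite lerDl first_diff_ge0.
Qed.

Lemma pickle_weight_lt e :
  0 < e -> exists K, forall i, (K <= pickle i)%N -> weight i < e.
Proof.
move=> e0; have [n ne] : exists n, 2^-1 ^+ n < e.
  exists (Num.truncn e^-1).
  rewrite exprVn -[ltRHS]invrK ltf_pV2 ?posrE ?exprn_gt0 ?invr_gt0//.
  apply: lt_le_trans (truncnS_gt _) _; rewrite -natrX ler_nat; exact: ltn_expl.
exists n => i ni; apply: le_lt_trans ne.
by rewrite /weight ler_wiXn2l ?invf_le1 ?ler1n.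
Qed.

End bits_metric.

HB.instance Definition _ (R : realType) (I : countType) :=
  @isMetric.Build R (bits R I) (@first_diff R I) (@first_diffxx R I)
    (@first_diff_eq0 R I) (@first_diffC R I) (@first_diff_triangle R I).

(** * Cylinders, second countability and completeness *)

Section bits_topology.
Variables (R : realType) (I : countType).
Implicit Types (x y : bits R I) (A : set (bits R I)).

Lemma bits_ballE x e : ball x e = [set y | first_diff R x y < e].
Proof. exact: (@ballEmdist R (bits R I)). Qed.

Definition cyl (s : seq I) (x : I -> bool) : set (bits R I) :=
  [set y | forall i, i \in s -> x i = y i].

Lemma cyl_nbhs s x : nbhs x (cyl s x).
Proof.
elim: s => [|i s IH]; first by apply: filterS filterT => y _ i.
apply: filterS (filterI IH (nbhsx_ballx x _ (weight_gt0 R i))).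
move=> y [ys]; rewrite bits_ballE /= => xy j; rewrite inE => /predU1P[->|/ys//].
by apply: contrapT => /(weight_le_first_diff R); rewrite leNgt xy.
Qed.

Lemma nbhs_cyl x A : nbhs x A -> exists s, cyl s x `<=` A.
Proof.
move=> /nbhs_ballP[e /= e0 xA].
have [K Ke] := @pickle_weight_lt R I _ (divr_gt0 e0 (@ltr0n R 2)).
exists (pmap (@unpickle I) (iota 0 K)) => y xy; apply: xA.
rewrite bits_ballE /=; apply: (@le_lt_trans _ _ (e / 2)); last first.
  by rewrite ltr_pdivrMr// ltr_pMr ?ltr1n.
apply: first_diff_le => [|i ei]; first by rewrite divr_ge0// ltW.
apply: xy; rewrite mem_pmap; apply/mapP; exists (pickle i).
  rewrite mem_iota /= add0n ltnNge; apply/negP => /Ke.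
  by rewrite ltNge (ltW ei).
by rewrite pickleK.
Qed.

Lemma open_bitsP A :
  open A <-> forall x, A x -> exists s, cyl s x `<=` A.
Proof.
split => [oA x Ax|h]; first by apply: nbhs_cyl; apply: open_nbhs_nbhs.
rewrite openE => x /h[s sA]; rewrite /interior.
by apply: filterS sA _; exact: cyl_nbhs.
Qed.

Lemma cyl_open s x : open (cyl s x).
Proof.
apply/open_bitsP => y xy; exists s => z yz i si.
by rewrite (xy i si) yz.
Qed.

(** Pairs of finite lists index all cylinders, so there are countably many; the second list holds
    the coordinates with value 1. *)
Definition code_cyl (p : seq I * seq I) : set (bits R I) :=
  cyl p.1 (fun i => i \in p.2).

Lemma cyl_code s x : cyl s x = code_cyl (s, [seq i <- s | x i]).
Proof.
apply/seteqP; split => y /= xy i si.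
  by rewrite mem_filter si andbT xy.
by have := xy i si; rewrite mem_filter si andbT.
Qed.

Lemma open_bits_bigcup A : open A ->
  A = \bigcup_p (if `[< code_cyl p `<=` A >] then code_cyl p else set0).
Proof.
move=> oA; apply/seteqP; split => t.
  move=> At; have [s] := (open_bitsP A).1 oA _ At.
  rewrite cyl_code => sA; exists (s, [seq i <- s | t i]) => //.
  by rewrite asboolT// -cyl_code => i _.
by move=> [p _]; case: asboolP => // pA /pA.
Qed.

Lemma countable_cyl : countable [set A | exists s x, A = cyl s x].
Proof.
apply: (@sub_countable _ _ _ (range code_cyl)).
  apply: subset_card_le => A [s [x ->]]; rewrite cyl_code.
  by exists (s, [seq i <- s | x i]).
by apply: card_le_trans (card_image_le _ _) _; exact: countableP.
Qed.

Lemma bits_second_countable : @second_countable (bits R I).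
Proof.
exists [set A | exists s x, A = cyl s x]; first exact: countable_cyl.
split => [A [s [x ->]]|x A /nbhs_cyl[s sA]]; first exact: cyl_open.
by exists (cyl s x) => //; split; [exists s, x|].
Qed.

(** Along a Cauchy filter each coordinate is eventually constant, which gives the limit
    coordinatewise. *)
Lemma bits_complete (F : set_system (bits R I)) :
  ProperFilter F -> cauchy F -> cvg F.
Proof.
move=> FF /cauchy_ballP Fc.
have Fi i : exists b, F [set y | y i = b].
  have /= := Fc _ (weight_gt0 R i).
  case=> -[/= A B] [FA FB] /= AB.
  have [x [Ax Bx]] := filter_ex (filterI FA FB).
  exists (x i); apply: filterS FB => y By /=.
  have /= := AB (x, y) (conj Ax By); rewrite bits_ballE /= => xy.
  by apply: contrapT => /nesym/(weight_le_first_diff R); rewrite leNgt xy.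
have [l Fl] := choice Fi.
apply/cvg_ex; exists (l : bits R I) => A /nbhs_cyl[s sA].
apply: filterS sA _.
elim: s => [|i s IH]; first by apply: filterS filterT => y _ i.
apply: filterS (filterI IH (Fl i)) => y [ys yi] j.
by rewrite inE => /predU1P[->//|/ys].
Qed.

HB.instance Definition _ := Uniform_isComplete.Build (bits R I) bits_complete.

End bits_topology.

Arguments cyl R {I} s x.
Arguments code_cyl R {I} p.

Definition borel_bits (R : realType) (I : countType) :=
  g_sigma_algebraType (@open (bits R I)).

HB.instance Definition _ (R : realType) (I : countType) :=
  Measurable.on (borel_bits R I).

Lemma bits_standard_borel (R : realType) (I : countType) :
  standard_borel R (borel_bits R I).
Proof.
exists (bits R I : completePseudoMetricType R), id; split.
- exact: (@metric_hausdorff R (bits R I)).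
- exact: bits_second_countable.
- by exists id.
- by move=> A; rewrite image_id.
Qed.

(** * Independent fair bits *)

Section bits_measurable.
Variables (R : realType) (I : countType).

Lemma measurable_coord (i : I) (b : bool) :
  measurable [set x : borel_bits R I | x i = b].
Proof.
apply: sub_sigma_algebra; have -> : [set x : borel_bits R I | x i = b] =
    cyl R [:: i] (fun=> b).
  apply/seteqP; split => x /= xi; first by move=> j; rewrite inE => /eqP ->.
  by rewrite -(xi i) ?mem_head.
exact: cyl_open.
Qed.

Lemma measurable_bits d (T : measurableType d) (f : T -> borel_bits R I) :
  (forall i b, measurable [set t | f t i = b]) -> measurable_fun setT f.
Proof.
move=> mf; have mcyl s x : measurable (f @^-1` (cyl R s x)).
  elim: s => [|i s IH].
    by rewrite (_ : _ @^-1` _ = setT) //; apply/seteqP; split.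
  rewrite (_ : _ @^-1` _ = [set t | f t i = x i] `&` f @^-1` (cyl R s x)).
    exact: measurableI.
  apply/seteqP; split => t /= => [h|[hi hs] j].
    by split => [|j js]; rewrite h// inE ?eqxx ?js ?orbT.
  by rewrite inE => /predU1P[->//|/hs].
have := @measurability _ _ T (borel_bits R I) setT f (@open (bits R I)); apply; first by [].
move=> _ [A oA <-]; rewrite setTI.
rewrite (open_bits_bigcup oA) preimage_bigcup.
apply: countable_bigcupT_measurable => [|p]; first exact: countableP.
by case: asboolP => // _; rewrite ?preimage_set0//; exact: mcyl.
Qed.

(** Binary expansion carries Lebesgue measure on [0,1) to independent fair bits; this is how [coin]
    is obtained without constructing an infinite product. *)
Definition binary_digit (t : measurableTypeR R) : borel_bits R I :=
  fun i => odd (Num.truncn (2 ^+ (pickle i).+1 * (t : R))).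

Lemma measurable_binary_digit :
  measurable_fun setT binary_digit.
Proof.
have mt (i : I) : measurable [set t : R | binary_digit t i].
  rewrite /binary_digit; set c : R := 2 ^+ _.
  have c0 : 0 < c by rewrite exprn_gt0.
  have -> : [set t : R | odd (Num.truncn (c * t))] =
     \bigcup_m [set` if odd m then `[m%:R / c, m.+1%:R / c[ else `]0, 0[].
    apply/seteqP; split => t /=.
      move=> ot; exists (Num.truncn (c * t)) => //=; rewrite ot /= in_itv /=.
      rewrite ler_pdivrMr// ltr_pdivlMr// [t * c]mulrC.
      apply: truncn_itv; rewrite leNgt; apply/negP => ct.
      (* [truncn] is 0, hence even, at negative numbers. *)
      move: ot; rewrite (_ : Num.truncn _ = 0%N)//; apply/truncn0Pn.
      by rewrite -ltNge (lt_trans ct).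
    move=> [m _]; case: ifP => om; rewrite /= in_itv /=; last first.
      by move=> /andP[t0 /(lt_trans t0)]; rewrite ltxx.
    rewrite ler_pdivrMr// ltr_pdivlMr// [t * c]mulrC => /truncn_def ->.
    exact: om.
  apply: bigcupT_measurable => m; case: ifP => _; exact: measurable_itv.
suff : measurable_fun setT (binary_digit : R -> borel_bits R I) by [].
apply: measurable_bits => i [|]; first exact: mt.
rewrite (_ : [set _ | _] = ~` [set t | binary_digit t i]).
  exact: measurableC.
by apply/seteqP; split => t /=; [move=> ->|move/negP/negbTE].
Qed.

HB.instance Definition _ :=
  isMeasurableFun.Build _ _ _ _ binary_digit
    measurable_binary_digit.

End bits_measurable.

Definition unit_lebesgue (R : realType) :=
  mrestr (@lebesgue_measure R) (measurable_itv `[0%R, 1%R[).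

HB.instance Definition _ (R : realType) := Measure.on (@unit_lebesgue R).

Lemma unit_lebesgue_setT (R : realType) : unit_lebesgue [set: R] = 1%E.
Proof.
rewrite /unit_lebesgue /mrestr setTI lebesgue_measure_itv /=.
by rewrite lte01 oppr0 adde0.
Qed.

HB.instance Definition _ (R : realType) :=
  Measure_isProbability.Build _ _ _ (@unit_lebesgue R) (@unit_lebesgue_setT R).

Definition coin (R : realType) (I : countType) :
    probability (borel_bits R I) R :=
  distribution (@unit_lebesgue R) (@binary_digit R I).

Section coin.
Variables (R : realType) (I : countType).
Implicit Types (s : seq I) (x : I -> bool).
Local Notation coin := (coin R I).

(** On a dyadic interval of level [K] the digits are those of its index [m], read from the top. *)
Lemma binary_digit_dyadic K m (t : R) (i : I) : (pickle i < K)%N ->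
  m%:R / 2 ^+ K <= t < m.+1%:R / 2 ^+ K ->
  binary_digit t i = bit (K - (pickle i).+1) m.
Proof.
move=> iK; have K0 k : 0 < 2 ^+ k :> R by rewrite exprn_gt0.
rewrite ler_pdivrMr// ltr_pdivlMr// => /andP[mt tm].
rewrite /binary_digit /bit; congr odd; apply: truncn_def.
set q := (_ %/ _)%N; set k := (K - _)%N in q *.
have KE : (2 : R) ^+ K = 2 ^+ (pickle i).+1 * 2 ^+ k.
  by rewrite -exprD subnKC.
rewrite KE mulrA -!natrX in mt tm.
rewrite -(ler_pM2r (K0 k)) -[X in _ && X](ltr_pM2r (K0 k)) !(mulrC _ t).
rewrite -!natrX -!natrM; apply/andP; split.
  by apply: le_trans mt; rewrite ler_nat leq_divM.
apply: lt_le_trans tm _; rewrite ler_nat.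
by rewrite ltn_ceil // expn_gt0.
Qed.

(** Within [0,1) the cylinder is a disjoint union of dyadic intervals of level [K] whose indices
    have [size s] prescribed digits: [2 ^ (K - size s)] intervals of length [2 ^ -K]. *)
Lemma coin_cyl s x : uniq s -> coin (cyl R s x) = (2^-1 ^+ size s)%:E.
Proof.
move=> us; pose K := (\max_(i <- s) pickle i).+1.
have sK i : i \in s -> (pickle i < K)%N.
  by move=> si; rewrite ltnS; apply: leq_bigmax_seq.
have K0 : 0 < 2 ^+ K :> R by rewrite exprn_gt0.
pose P m := all (fun i => x i == bit (K - (pickle i).+1) m) s.
pose J m : set R := [set` `[m%:R / 2 ^+ K, m.+1%:R / 2 ^+ K[ ].
have E : @binary_digit R I @^-1` cyl R s x `&` [set` `[0, 1[ ] =
    \big[setU/set0]_(m < 2 ^ K | P m) J m.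
  rewrite big_mkcond /= -(bigcup_mkord _ (fun m => if P m then J m else set0)).
  apply/seteqP; split => t.
    move=> [/= tx]; rewrite in_itv /= => /andP[t0 t1].
    have t0' : 0 <= 2 ^+ K * t by rewrite mulr_ge0// ltW.
    pose m := Num.truncn (2 ^+ K * t).
    have mK : (m < 2 ^ K)%N.
      rewrite truncn_lt_nat// natrX -[ltRHS]mulr1 ltr_pM2l//.
    have Jt : m%:R / 2 ^+ K <= t < m.+1%:R / 2 ^+ K.
      by rewrite ler_pdivrMr// ltr_pdivlMr// [t * _]mulrC truncn_itv.
    exists m => //=; rewrite ifT; first by rewrite /J /= in_itv.
    apply/allP => i si; apply/eqP.
    by rewrite tx// (binary_digit_dyadic _ Jt) ?sK.
  move=> [m /= mK]; case: ifP => // /allP Pm; rewrite /J /= !in_itv /= => Jt; split.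
    by move=> i si; rewrite (eqP (Pm i si)) (binary_digit_dyadic _ Jt) ?sK.
  case/andP: Jt => mt tm; rewrite (le_trans _ mt) ?divr_ge0// ?(ltW K0)//=.
  by rewrite (lt_le_trans tm)// ler_pdivrMr// mul1r -natrX ler_nat.
have -> : coin (cyl R s x) =
    lebesgue_measure (\big[setU/set0]_(m < 2 ^ K | P m) J m).
  by rewrite -E.
rewrite (@measure_bigsetU_ord _ _ _ (@lebesgue_measure R) (2 ^ K) (fun m => P m)
  (fun m => J m)); first last.
- apply/trivIsetP => m n _ _ mn; apply/seteqP; split => // t [].
  rewrite /J /= !in_itv /= !ler_pdivrMr// !ltr_pdivlMr//.
  move=> /truncn_def tm /truncn_def tn; case/eqP: mn.
  by apply: val_inj; rewrite /= -tm tn.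
- by move=> m; exact: measurable_itv.
transitivity (\sum_(m < 2 ^ K | P m) (2^-1 ^+ K)%:E : \bar R)%E.
  apply: eq_bigr => m _; rewrite /= /J lebesgue_measure_itv /= lte_fin.
  rewrite ltr_pM2r ?invr_gt0// ltr_nat ltnSn -EFinD -mulrBl.
  by rewrite -natrB// subSnn mul1r exprVn.
rewrite sumEFin sumr_const -sum1_card; congr EFin.
have -> : (\sum_(m in fun m : 'I_(2 ^ K) => P m) 1 = 2 ^ (K - size s))%N.
  pose S k := has (fun i => k == K - (pickle i).+1)%N s.
  pose b k := if unpickle (K - k.+1) is Some i then x i else false.
  have iE i : i \in s -> (K - (K - (pickle i).+1).+1)%N = pickle i.
    by move=> /sK; lia.
  have PE m : P m = all (fun k => S k ==> (bit k m == b k)) (iota 0 K).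
    apply/allP/allP => [h k _|h i si].
      apply/implyP => /hasP[i si /eqP ->].
      by rewrite /b iE// pickleK eq_sym h.
    have /h : (K - (pickle i).+1)%N \in iota 0 K.
      by rewrite mem_iota /= add0n; have := sK _ si; lia.
    rewrite /b iE// pickleK eq_sym => /implyP; apply.
    by apply/hasP; exists i.
  transitivity (\sum_(0 <= m < 2 ^ K) P m)%N.
    rewrite big_mkord [LHS]big_mkcond; apply: eq_bigr => m _.
    by rewrite unfold_in; case: (P m).
  under eq_bigr do rewrite PE.
  rewrite sum_bits_eq; congr (2 ^ _)%N.
  have : count S (iota 0 K) = size s.
    rewrite -size_filter -(size_map (fun i => K - (pickle i).+1)%N).
    apply/perm_size/uniq_perm.
    - by rewrite filter_uniq// iota_uniq.
    - rewrite map_inj_in_uniq// => i j si sj ij.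
      by apply: (pcan_inj pickleK); rewrite -(iE i)// ij iE.
    - move=> k; rewrite mem_filter mem_iota /= add0n.
      apply/andP/mapP => [[/hasP[i si /eqP ->] _]|[i si ->]]; first by exists i.
      by split; [apply/hasP; exists i|have := sK _ si; lia].
  by have := count_predC S (iota 0 K); rewrite size_iota => {3}<- ->; rewrite addKn.
have sK' : (size s <= K)%N.
  rewrite -(size_map pickle) -(size_iota 0 K); apply: uniq_leq_size.
    by rewrite map_inj_uniq//; exact: pcan_inj pickleK.
  by move=> _ /mapP[i /sK si ->]; rewrite mem_iota.
rewrite -[in LHS](subnK sK') exprD -mulrnAl -mulr_natl natrX.
by rewrite addnK -exprMn divff// expr1n mul1r.
Qed.

Lemma cylI s s' x x' : cyl R s x `&` cyl R s' x' = set0 \/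
  exists s'' x'', cyl R s x `&` cyl R s' x' = cyl R s'' x''.
Proof.
have [->|/set0P[y [ys ys']]] := eqVneq (cyl R s x `&` cyl R s' x') set0.
  by left.
right; exists (s ++ s'), y; apply/seteqP; split => z /=.
  move=> [zs zs'] i; rewrite mem_cat => /orP[] si.
    by rewrite -ys// zs.
  by rewrite -ys'// zs'.
by move=> h; split => i si; rewrite ?ys ?ys'// h// mem_cat si ?orbT.
Qed.

(** Cylinders, together with the empty set, are stable under intersection and generate the Borel
    sets. *)
Lemma coin_unique (m : {measure set (borel_bits R I) -> \bar R}) :
  (forall s x, uniq s -> m (cyl R s x) = (2^-1 ^+ size s)%:E) ->
  forall A, measurable A -> m A = coin A.
Proof.
move=> mcyl; pose G := [set A : set (borel_bits R I) |
  A = set0 \/ exists s x, A = cyl R s x].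
have GT : G setT.
  by right; exists [::], (fun=> false); apply/seteqP; split.
have mG A : G A -> m A = coin A.
  case=> [->|[s [x ->]]]; first by rewrite !measure0.
  have -> : cyl R s x = cyl R (undup s) x.
    by apply/seteqP; split => y /= h i; move: (h i); rewrite mem_undup.
  by rewrite mcyl ?coin_cyl ?undup_uniq.
have oG A : open (A : set (bits R I)) -> <<s G >> A.
  move=> oA; rewrite (open_bits_bigcup oA).
  pose GT' := g_sigma_algebraType G.
  apply: (@countable_bigcupT_measurable _ GT'); first exact: countableP.
  move=> p; case: asboolP => _; last exact: measurable0.
  by apply: sub_sigma_algebra; right; eexists; eexists.
move=> A mA; apply: (g_sigma_algebra_measure_unique G _ (fun=> setT)) => //.
- move=> B [->|[s [x ->]]]; first exact: measurable0.
  by apply: sub_sigma_algebra; exact: cyl_open.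
- by rewrite bigcup_const//; exists 0%N.
- move=> B C [->|[s [x ->]]] [->|[s' [x' ->]]]; rewrite ?set0I ?setI0; try by left.
  exact: cylI.
- by move=> _; rewrite (mG _ GT) probability_setT ltry.
- by apply: (smallest_sub _ oG) mA; exact: smallest_sigma_algebra.
Qed.

(** An injective [sigma] pulls a cylinder back to a cylinder on equally many coordinates, so
    [coin_unique] applies. *)
Lemma coin_permute (sigma : I -> I) (c : I -> bool) (A : set (borel_bits R I)) :
  injective sigma -> measurable A ->
  coin ((fun x i => x (sigma i) (+) c i) @^-1` A) = coin A.
Proof.
move=> sinj; pose f (x : borel_bits R I) : borel_bits R I :=
  fun i => x (sigma i) (+) c i.
have mf : measurable_fun setT f.
  apply: measurable_bits => i b.
  rewrite (_ : [set _ | _] = [set x : borel_bits R I | x (sigma i) = b (+) c i]).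
    exact: measurable_coord.
  by apply/seteqP; split => x /=; rewrite /f; [move=> <-|move=> ->]; rewrite addbK.
pose F : {mfun borel_bits R I >-> borel_bits R I} := mfun_Sub (mem_set mf).
move: A; apply: (@coin_unique (distribution coin F)) => s x us.
(* The value prescribed at [sigma i] is [x i (+) c i]; the existential expresses it without an
   inverse of [sigma]. *)
transitivity (coin (cyl R (map sigma s) (fun j => [exists i : seq_sub s,
   (sigma (val i) == j) && (x (val i) (+) c (val i))]))); last first.
  by rewrite coin_cyl ?map_inj_uniq// size_map.
rewrite /distribution /pushforward; congr (coin _).
have E i : i \in s -> [exists j : seq_sub s,
   (sigma (val j) == sigma i) && (x (val j) (+) c (val j))] = x i (+) c i.
  move=> si; apply/existsP/idP => [[j /andP[/eqP/sinj -> //]]|xi].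
  by exists (SeqSub si); rewrite eqxx.
apply/seteqP; split => y /=.
  by move=> h _ /mapP[i si ->]; rewrite E// (h i si) addbK.
move=> h i si; have := h (sigma i) (map_f sigma si).
by rewrite /f E// => <-; rewrite addbK.
Qed.

End coin.

(** * The odometer extension *)

(* A natural number e also stands for the finite set of the positions of its
   binary digits 1, with Nat.lxor as symmetric difference. *)
Section bitset.
Local Open Scope nat_scope.
Implicit Types (f : pred nat) (k n : nat).

Fixpoint bitset f n : nat :=
  if n is m.+1 then (if f m then PeanoNat.Nat.setbit (bitset f m) m else bitset f m)
  else 0.

Lemma testbit_bitset f n k : Nat.testbit (bitset f n) k = f k && (k < n).
Proof.
elim: n => [|n IH] /=; first by rewrite PeanoNat.Nat.bits_0 andbF.
case: ifP => fn; rewrite ?PeanoNat.Nat.setbit_eqb IH [in RHS]ltnS [in RHS]leq_eqVlt.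
  have -> : Nat.eqb n k = (k == n).
    by apply/idP/eqP => [/PeanoNat.Nat.eqb_eq ->|->]; rewrite ?PeanoNat.Nat.eqb_refl.
  by have [->|] := eqVneq k n; rewrite ?fn.
by have [->|] := eqVneq k n; rewrite ?fn.
Qed.

Lemma testbit_inj (e e' : nat) : (forall k, Nat.testbit e k = Nat.testbit e' k) -> e = e'.
Proof. exact: PeanoNat.Nat.bits_inj. Qed.

Lemma testbit_lxor (e e' k : nat) :
  Nat.testbit (Nat.lxor e e') k = Nat.testbit e k (+) Nat.testbit e' k.
Proof. by rewrite PeanoNat.Nat.lxor_spec; case: Nat.testbit; case: Nat.testbit. Qed.

Lemma lxorA (a b c : nat) : Nat.lxor (Nat.lxor a b) c = Nat.lxor a (Nat.lxor b c).
Proof. exact: PeanoNat.Nat.lxor_assoc. Qed.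

Lemma lxorK (m : nat) : involutive (fun e => Nat.lxor e m).
Proof. by move=> e; rewrite lxorA PeanoNat.Nat.lxor_nilpotent PeanoNat.Nat.lxor_0_r. Qed.

End bitset.
Arguments bitset : simpl never.

Definition first (p : pred nat) : option nat :=
  if pselect (exists n, p n) is left pn then Some (ex_minn pn) else None.

Variant first_spec (p : pred nat) : option nat -> Prop :=
  | FirstSome i of p i & (forall k, (k < i)%N -> ~~ p k) : first_spec p (Some i)
  | FirstNone of (forall k, ~~ p k) : first_spec p None.

Lemma firstP p : first_spec p (first p).
Proof.
rewrite /first; case: pselect => [pn|np]; constructor.
- by case: ex_minnP.
- case: ex_minnP => i _ imin k; rewrite ltnNge; apply: contra; exact: imin.
- by move=> k; apply/negP => pk; apply: np; exists k.
Qed.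

Lemma first_eq (p : pred nat) i :
  p i -> (forall k, (k < i)%N -> ~~ p k) -> first p = Some i.
Proof.
move=> pi imin; case: firstP => [k pk kmin|/(_ i)]; last by rewrite pi.
case: (ltngtP k i) => [/imin|/kmin|->//]; first by rewrite pk.
by rewrite pi.
Qed.

Section odometer.
Local Open Scope nat_scope.
Variable S : nat -> pred nat.
Notation config := (nat * nat -> bool).
Implicit Types (x y : config) (i j k e t N : nat).

(* The coordinate (0, k) is the k-th digit of the odometer, and (j.+1, e) is the
   value of z_j at the set e.  The odometer adds 1 by flipping all digits up to
   the first zero i; flip_all only acts on the null set without any zero. *)
Definition flip_to i x : config := fun c =>
  if c is (j.+1, e) then x (j.+1, Nat.lxor e (bitset (S j) i.+1))
  else x c (+) (c.2 <= i).

Definition flip_all x : config := fun c => x c (+) (c.1 == 0).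

Definition odometer x : config :=
  if first (fun k => ~~ x (0, k)) is Some i then flip_to i x else flip_all x.

Definition odometer_inv x : config :=
  if first (fun k => x (0, k)) is Some i then flip_to i x else flip_all x.

Lemma flip_toK i : involutive (flip_to i).
Proof.
move=> x; apply/funext => -[[|j] e] /=; first by rewrite addbK.
by rewrite lxorK.
Qed.

(** The flip turns the first zero into the first one, so the inverse selects the same [i], and
    [flip_to i] is an involution. *)
Lemma odometerK : cancel odometer odometer_inv.
Proof.
move=> x; rewrite /odometer; case: firstP => [i xi imin|allx].
  rewrite /odometer_inv (@first_eq _ i) ?flip_toK//=.
    by rewrite leqnn addbT.
  by move=> k ki; rewrite (ltnW ki) addbT; exact: imin.
rewrite /odometer_inv; case: firstP => [i|_].
  by rewrite /flip_all /= addbT => /negPf; have := allx i; case: (x _).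
by apply/funext => c; rewrite /flip_all addbK.
Qed.

Lemma odometer_invK : cancel odometer_inv odometer.
Proof.
move=> x; rewrite /odometer_inv; case: firstP => [i xi imin|allx].
  rewrite /odometer (@first_eq _ i) ?flip_toK//=.
    by rewrite leqnn addbT xi.
  by move=> k ki; rewrite (ltnW ki) addbT negbK; exact: imin.
rewrite /odometer; case: firstP => [i|_].
  by rewrite /flip_all /= addbT negbK => xi; have := allx i; rewrite xi.
by apply/funext => c; rewrite /flip_all addbK.
Qed.

(** A conull, forward invariant condition under which every carry stops and [flip_all] never
    occurs. *)
Definition aperiodic x := forall N, exists2 k, N <= k & ~~ x (0, k).

Definition num N x := \sum_(0 <= k < N) x (0, k) * 2 ^ k.

Lemma numS N x : num N.+1 x = num N x + x (0, N) * 2 ^ N.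
Proof. by rewrite /num big_nat_recr. Qed.

Lemma num_lt N x : num N x < 2 ^ N.
Proof.
elim: N => [|N IH]; first by rewrite /num big_geq.
by rewrite numS expnS mul2n -addnn; case: (x _); lia.
Qed.

Lemma num_mod N k x : k <= N -> num N x %% 2 ^ k = num k x.
Proof.
move=> /subnKC <-; elim: (N - k) => [|m IH].
  by rewrite addn0 modn_small// num_lt.
by rewrite addnS numS expnD mulnCA (mulnC (2 ^ k)) -modnDmr modnMl addn0.
Qed.

Lemma bit_num N k x : k < N -> bit k (num N x) = x (0, k).
Proof.
move=> kN; rewrite -(bit_modX (j := k.+1))// num_mod// numS.
by case: (x _); rewrite ?mul1n ?addn0 ?bit_addX ?bit_small ?num_lt.
Qed.

Lemma odometer_num N x : (exists k, ~~ x (0, k)) ->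
  num N (odometer x) = (num N x + 1) %% 2 ^ N.
Proof.
move=> [k0 xk0]; rewrite /odometer; case: firstP => [i xi imin|/(_ k0)]; last first.
  by rewrite xk0.
(* The term with [N <= i] is the carry out of the first [N] digits. *)
have H : num N (flip_to i x) + (N <= i) * 2 ^ N = num N x + 1.
  elim: N => [|N IH]; first by rewrite /num !big_geq.
  rewrite !numS /=; have [Ni|iN|Ni] := ltngtP N i.
  - have := imin _ Ni; rewrite negbK => xN; move: IH.
    by rewrite (ltnW Ni) xN /= expnS; lia.
  - by move: IH; rewrite leqNgt iN /= addbF; lia.
  - move: IH; rewrite Ni leqnn (negbTE xi) /=; lia.
rewrite -H; case: (N <= i); rewrite ?mul1n ?modnDr ?mul0n ?addn0;
  by rewrite modn_small// num_lt.
Qed.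

Lemma odometer_aperiodic x : aperiodic x -> aperiodic (odometer x).
Proof.
move=> ax N; rewrite /odometer; case: firstP => [i _ _|h].
  have [k Nk xk] := ax (maxn N i.+1); exists k; first lia.
  by rewrite /= (_ : k <= i = false) ?addbF//; lia.
by have [k _ xk] := ax 0; have := h k; rewrite xk.
Qed.

Lemma iter_aperiodic t x : aperiodic x -> aperiodic (iter t odometer x).
Proof. by move=> ax; elim: t => //= t; exact: odometer_aperiodic. Qed.

Lemma iter_num t N x : aperiodic x ->
  num N (iter t odometer x) = (num N x + t) %% 2 ^ N.
Proof.
move=> ax; elim: t => [|t IH] /=; first by rewrite addn0 modn_small// num_lt.
rewrite odometer_num ?IH; first by rewrite modnDml addn1 addnS.
by have [k _ xk] := iter_aperiodic t ax 0; exists k.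
Qed.

Definition carried x t k := 2 ^ k <= num k x + t %% 2 ^ k.

Lemma iter_digit t k x : aperiodic x ->
  iter t odometer x (0, k) = x (0, k) (+) (bit k t (+) carried x t k).
Proof.
move=> ax; rewrite -(@bit_num k.+1)// iter_num// bit_modX// bit_add.
by rewrite bit_num// -addbA /carry num_mod.
Qed.

(** Since [t] has no digits from [N] on, a carry reaches [k] exactly when it leaves the first [N]
    digits and meets only ones before [k]. *)
Lemma carried_high N k x t : t < 2 ^ N -> N <= k ->
  carried x t k = carried x t N && all (fun i => x (0, i)) (iota N (k - N)).
Proof.
move=> tN /subnKC <-; rewrite addKn; elim: (k - N) => [|m IH].
  by rewrite addn0 andbT.
have t2 j : N <= j -> t < 2 ^ j.
  by move=> Nj; apply: leq_trans tN _; rewrite leq_exp2l.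
rewrite -addn1 iotaD all_cat andbA -IH addn1 addnS /= andbT.
rewrite /carried numS !modn_small ?t2//; try lia.
have := t2 (N + m) (leq_addr _ _); have := num_lt (N + m) x.
by rewrite expnS; case: (x _) => /=; lia.
Qed.

(** Successive translations compose by symmetric difference, so [D] is the set of positions in [S j]
    whose digit differs between times 0 and [t]; [iter_digit] expresses it through carries. *)
Lemma iter_sections t x j : aperiodic x -> exists D,
  (forall k, Nat.testbit D k = S j k && (bit k t (+) carried x t k)) /\
  (forall e, iter t odometer x (j.+1, e) = x (j.+1, Nat.lxor e D)).
Proof.
move=> ax; suff [D [Db De]] : exists D,
    (forall k, Nat.testbit D k = S j k && (iter t odometer x (0, k) (+) x (0, k))) /\
    (forall e, iter t odometer x (j.+1, e) = x (j.+1, Nat.lxor e D)).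
  exists D; split => // k; rewrite Db iter_digit// addbC addKb//.
elim: t => [|t [D [Db De]]].
  exists 0; split => [k|e] /=; first by rewrite PeanoNat.Nat.bits_0 addbb andbF.
  by rewrite PeanoNat.Nat.lxor_0_r.
have [k0 _ xk0] := iter_aperiodic t ax 0.
rewrite iterS; move: (iter t odometer x) xk0 De Db => y yk0 De Db.
rewrite /odometer; case: firstP => [i yi imin|/(_ k0)]; last by rewrite yk0.
exists (Nat.lxor (bitset (S j) i.+1) D); split => [k|e] /=; last first.
  by rewrite De lxorA.
rewrite testbit_lxor testbit_bitset Db ltnS.
by case: (S j k) => //=; rewrite addbC addbAC.
Qed.

End odometer.

(** * The odometer extension preserves the coin measure *)

Section coin_odometer.
Variables (R : realType) (S : nat -> pred nat).
Local Notation X := (borel_bits R (nat * nat)%type).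
Local Notation coin := (coin R (nat * nat)%type).

Lemma measurable_forall_coord (P : pred nat) (c : nat -> nat * nat) (b : bool) :
  measurable [set x : X | forall n, P n -> x (c n) = b].
Proof.
rewrite (_ : [set _ | _] =
    \bigcap_n (if P n then [set x : X | x (c n) = b] else setT)).
  apply: bigcapT_measurable => n; case: ifP => _ //.
  exact: measurable_coord.
apply/seteqP; split => x /= h n; first by move=> _; case: ifP => // /h.
by move=> Pn; have := h n Logic.I; rewrite Pn.
Qed.

Lemma coin_constant0 (c : nat -> nat * nat) (b : bool) : injective c ->
  coin [set x : X | forall n, x (c n) = b] = 0%E.
Proof.
move=> cinj; have mA : measurable [set x : X | forall n, x (c n) = b].
  rewrite (_ : [set _ | _] = [set x : X | forall n, xpredT n -> x (c n) = b]).
    exact: measurable_forall_coord.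
  by apply/seteqP; split => x /= h n; rewrite h.
apply/eqP; rewrite eq_le measure_ge0 andbT; apply/lee_addgt0Pr => e e0.
rewrite add0e; have [K Ke] := @pickle_weight_lt R nat e e0.
have /ltW := Ke K (leqnn K); rewrite /weight -lee_fin; apply: le_trans.
have -> : pickle K = K by [].
rewrite -[X in 2^-1 ^+ X](size_iota 0) -(size_map c).
rewrite -(@coin_cyl R _ _ (fun=> b)) ?map_inj_uniq ?iota_uniq//.
apply: le_measure; rewrite ?inE//.
  by apply: sub_sigma_algebra; exact: cyl_open.
by move=> x /= h _ /mapP[n _ ->]; rewrite h.
Qed.

Lemma measurable_aperiodic : measurable [set x : X | aperiodic x].
Proof.
rewrite (_ : [set _ | _] = \bigcap_N ~` [set x : X | forall k, (N <= k)%N -> x (0%N, k) = true]).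
  apply: bigcapT_measurable => N; apply: measurableC.
  exact: measurable_forall_coord.
apply/seteqP; split => x /= h N.
  by move=> _ /= all1; have [k /all1 ->] := h N.
have /= := h N Logic.I; move=> /existsNP[k /not_implyP[Nk /negP xk]].
by exists k.
Qed.

Lemma coin_aperiodicC : coin (~` [set x : X | aperiodic x]) = 0%E.
Proof.
apply/eqP; rewrite eq_le measure_ge0 andbT.
pose F N := [set x : X | forall k, x (0%N, (N + k)%N) = true].
have mF N : measurable (F N).
  rewrite (_ : F N = [set x : X | forall k, xpredT k -> x (0%N, (N + k)%N) = true]).
    exact: measurable_forall_coord.
  by apply/seteqP; split => x /= h n; rewrite h.
have F0 N : coin (F N) = 0%E by apply: coin_constant0 => k k' [] /addnI.
apply: le_trans (_ : \sum_(N <oo) coin (F N) <= _)%E; last first.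
  by rewrite eseries0// => N _ _; exact: F0.
apply: measure_sigma_subadditive => //.
  exact: (measurableC measurable_aperiodic).
move=> x /= /existsNP[N h]; exists N => // k.
by apply/negPn/negP => xk; apply: h; exists (N + k)%N => //; exact: leq_addr.
Qed.

Lemma measurable_permute (sigma : nat * nat -> nat * nat) (c : nat * nat -> bool) :
  measurable_fun setT (fun (x : X) => (fun i => x (sigma i) (+) c i) : X).
Proof.
apply: measurable_bits => i b.
rewrite (_ : [set _ | _] = [set x : X | x (sigma i) = b (+) c i]).
  exact: measurable_coord.
by apply/seteqP; split => x /=; [move=> <-|move=> ->]; rewrite addbK.
Qed.

Let sigma i (c : nat * nat) :=
  if c is (j.+1, e) then (j.+1, Nat.lxor e (bitset (S j) i.+1)) else c.

Let flip_toE i : flip_to S i =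
  fun x c => x (sigma i c) (+) ((c.1 == 0%N) && (c.2 <= i)%N).
Proof. by apply/funext => x; apply/funext => -[[|j] e] //=; rewrite addbF. Qed.

Let flip_allE : flip_all = fun x c => x (id c) (+) (c.1 == 0%N).
Proof. by []. Qed.

Let mflip_to i : measurable_fun setT (flip_to S i : X -> X).
Proof. by rewrite flip_toE; exact: measurable_permute. Qed.

Let mflip_all : measurable_fun setT (flip_all : X -> X).
Proof. by rewrite flip_allE; exact: measurable_permute. Qed.

Let coin_flip_to i (A : set X) : measurable A ->
  coin (flip_to S i @^-1` A) = coin A.
Proof.
move=> mA; rewrite flip_toE (coin_permute _ _ mA)//.
move=> [[|j] e] [[|j'] e'] //= [<-] // h; congr (_, _).
by apply: (can_inj (lxorK (bitset (S j) i.+1))).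
Qed.

(** On each piece the odometer ([b = false]) or its inverse ([b = true]) is a single [flip_to S i];
    treating both at once yields the measurability of both maps. *)
Let piece (b : bool) i := [set x : X | x (0%N, i) = b /\
  forall k, (k < i)%N -> x (0%N, k) = ~~ b].
Let rest (b : bool) := [set x : X | forall k, x (0%N, k) = b].

Let mpiece b i : measurable (piece b i).
Proof.
apply: measurableI; first exact: measurable_coord.
exact: (@measurable_forall_coord (fun k => (k < i)%N) (pair 0%N)).
Qed.

Let mrest b : measurable (rest b).
Proof.
rewrite (_ : rest b = [set x : X | forall k, xpredT k -> x (0%N, k) = b]).
  exact: (measurable_forall_coord xpredT (pair 0%N)).
by apply/seteqP; split => x /= h k; rewrite h.
Qed.

Let piece_first b i x : piece b i x -> first (fun k => x (0%N, k) == b) = Some i.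
Proof.
move=> [xi xk]; apply: first_eq; first by rewrite xi.
by move=> k /xk ->; case: b {xi xk}.
Qed.

Let piece_trivIset b : trivIset setT (piece b).
Proof.
apply/trivIsetP => i j _ _ ij; apply/seteqP; split => // x [/piece_first xi].
by move=> /piece_first; rewrite xi => -[] /eqP; rewrite (negbTE ij).
Qed.

Let step b (x : X) : X :=
  if first (fun k => x (0%N, k) == b) is Some i then flip_to S i x
  else flip_all x.

Let preimage_step b (A : set X) : step b @^-1` A =
  (\bigcup_i (piece b i `&` flip_to S i @^-1` A)) `|`
  (rest (~~ b) `&` flip_all @^-1` A).
Proof.
apply/seteqP; split => x /=.
  rewrite /step; case: firstP => [i /eqP xi imin Ax|h Ax]; [left|right].
    exists i => //; split => //; split => // k /imin.
    by case: (x _) b {xi Ax imin} => -[].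
  by split => // k; have := h k; case: (x _) b {Ax h} => -[].
rewrite /step => -[[i _ [/piece_first -> //]]|[h Ax]].
case: firstP => // i /eqP xi _; have := h i; rewrite xi.
by case: b {h xi}.
Qed.

Let measurable_step b : measurable_fun setT (step b).
Proof.
move=> _ A mA; rewrite setTI preimage_step; apply: measurableU.
  apply: bigcupT_measurable => i; apply: measurableI; first exact: mpiece.
  by rewrite -[X in measurable X]setTI; exact: mflip_to.
apply: measurableI; first exact: mrest.
by rewrite -[X in measurable X]setTI; exact: mflip_all.
Qed.

Let odometer_step : odometer S = step false.
Proof.
apply/funext => x; rewrite /odometer /step; congr (if first _ is Some i then _ else _).
by apply/funext => k; case: (x _).
Qed.

Let odometer_inv_step : odometer_inv S = step true.
Proof.
apply/funext => x; rewrite /odometer_inv /step.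
rewrite (_ : (fun k => x (0%N, k) == true) = (fun k => x (0%N, k)))//.
by apply/funext => k; rewrite eqb_id.
Qed.

Lemma measurable_odometer : measurable_fun setT (odometer S : X -> X).
Proof. by rewrite odometer_step; exact: measurable_step. Qed.

Lemma measurable_odometer_inv : measurable_fun setT (odometer_inv S : X -> X).
Proof. by rewrite odometer_inv_step; exact: measurable_step. Qed.

Let coin_rest b (A : set X) : measurable A -> coin (rest b `&` A) = 0%E.
Proof.
move=> mA; apply/eqP; rewrite eq_le measure_ge0 andbT.
rewrite -(@coin_constant0 (pair 0%N) b); last by move=> ? ? [].
apply: le_measure; rewrite ?inE; last by move=> x [].
  by apply: measurableI => //; exact: mrest.
exact: mrest.
Qed.

Let coin_split b (A B : set X) (F : nat -> set X) : measurable B ->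
  (forall i, measurable (F i)) ->
  coin ((\bigcup_i (piece b i `&` F i)) `|` (rest (~~ b) `&` B)) =
  (\sum_(i <oo) coin (piece b i `&` F i))%E.
Proof.
move=> mB mF; have mU : measurable (\bigcup_i (piece b i `&` F i)).
  by apply: bigcupT_measurable => i; exact: measurableI.
rewrite measureU0//; last exact: coin_rest.
  transitivity (\sum_(i <oo | i \in [set: nat]) coin (piece b i `&` F i))%E.
    apply: measure_bigcup; first by move=> i _; exact: measurableI.
    by apply: trivIset_setIr; exact: piece_trivIset.
  by apply: eq_eseriesl => i; rewrite in_setT.
exact: measurableI.
Qed.

(** [flip_to S i] preserves the measure and exchanges the pieces with first zero at [i] and first
    one at [i]; either family exhausts the space up to a null set. *)
Lemma coin_odometer (A : set X) : measurable A ->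
  coin (odometer S @^-1` A) = coin A.
Proof.
move=> mA; rewrite odometer_step preimage_step.
have mto i : measurable (flip_to S i @^-1` A : set X).
  by rewrite -[X in measurable X]setTI; exact: mflip_to.
have mall : measurable (flip_all @^-1` A : set X).
  by rewrite -[X in measurable X]setTI; exact: mflip_all.
rewrite coin_split//.
have AE : A = (\bigcup_i (piece true i `&` A)) `|` (rest false `&` A).
  apply/seteqP; split => x; last by move=> [[i _ []]|[]].
  move=> Ax; case: (firstP (fun k => x (0%N, k))) => [i xi imin|h]; [left|right].
    by exists i => //; split => //; split => // k /imin/negbTE.
  by split => // k; apply/negbTE.
rewrite [in RHS]AE coin_split//.
apply: eq_eseriesr => i _; rewrite -(@coin_flip_to i (piece true i `&` A)).
  congr (coin _); apply/seteqP; split => x /= [[xi xk] Ax]; do 2?split => //=.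
  - by rewrite leqnn xi.
  - by move=> k ki; rewrite xk// (ltnW ki).
  - by move: xi => /=; rewrite leqnn addbT; case: (x _).
  - by move=> k ki; move: (xk k ki) => /=; rewrite (ltnW ki) addbT; case: (x _).
exact: measurableI.
Qed.

Lemma odometer_system : measure_preserving_system coin (odometer S).
Proof.
split; first exact: bits_standard_borel.
split; [exact: measurable_odometer| |exact: coin_odometer].
exists (odometer_inv S); split;
  [exact: odometerK|exact: odometer_invK|exact: measurable_odometer_inv].
Qed.

End coin_odometer.

(** * The metric as an integrable generating semimetric *)

Section first_diff_semimetric.
Variables (R : realType) (I : countType).
Local Notation X := (borel_bits R I).
Local Notation rho := (@first_diff R I : X -> X -> R).

Lemma measurable_first_diff :
  measurable_fun setT (fun p : X * X => rho p.1 p.2).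
Proof.
apply: (measurability _ (RGenOInfty.measurableE R)) => _ [_ [e ->] <-].
rewrite setTI.
have [e0|e0] := ltP e 0.
  rewrite (_ : _ @^-1` _ = setT) //; apply/seteqP; split => // p _ /=.
  by rewrite in_itv /= andbT (lt_le_trans e0)// first_diff_ge0.
rewrite (_ : _ @^-1` _ = ~` \bigcap_(n in setT) (if unpickle n is Some i then
    (if e < weight R i then [set p : X * X | p.1 i = p.2 i] else setT) else setT)).
  apply: measurableC; apply: bigcapT_measurable => n.
  case: unpickle => [i|//]; case: ifP => // _.
  rewrite (_ : [set _ | _] =
    (([set x : X | x i = true] `*` [set x : X | x i = true]) `|`
     ([set x : X | x i = false] `*` [set x : X | x i = false]))).
    by apply: measurableU; apply: measurableX; exact: measurable_coord.
  apply/seteqP; split => -[x y] /=; last by move=> [[-> ->]|[-> ->]].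
  by move=> ->; case: (y i); [left|right].
apply/seteqP; split => -[x y] /=; rewrite in_itv /= andbT.
  move=> exy h; move: exy; rewrite ltNge => /negP; apply.
  apply: first_diff_le => // i ei.
  by have := h (pickle i) Logic.I; rewrite pickleK ei.
move=> h; rewrite ltNge; apply/negP => /(first_diff_leP _ _ e0) xy.
apply: h => n _; case: unpickle => // i; case: ifP => // ei.
exact: xy.
Qed.

Lemma first_diff_semimetric : measurable_semimetric rho.
Proof.
split; [exact: first_diffC|exact: first_diff_ge0|exact: measurable_first_diff|].
by move=> x y z; exact: first_diff_triangle.
Qed.

Lemma first_diff_integrable (mu : probability X R) :
  (\int[mu \x mu]_p (rho p.1 p.2)%:E < +oo)%E.
Proof.
apply: (@le_lt_trans _ _ (\int[mu \x mu]_p (cst 1%:E p))%E); last first.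
  rewrite integral_cst// mul1e.
  rewrite -setXTT [ltLHS]product_measure1E//.
  by rewrite [X in (X * _)%E](probability_setT mu)
    [X in (_ * X)%E](probability_setT mu) mule1 ltry.
apply: ge0_le_integral => //=.
- by move=> p _; rewrite lee_fin first_diff_ge0.
- by apply/measurable_EFinP; exact: measurable_first_diff.
- by move=> p _; rewrite lee_fin first_diff_le1.
Qed.

Lemma first_diff_generating (mu : probability X R) (T : X -> X) :
  generating mu T rho.
Proof.
exists setT; split; first by rewrite setCT; exact: negligible_set0.
move=> x y _ _ xy; exists 1%N => //; rewrite /averaged big_ord1 invr1 mul1r /=.
rewrite lt_neqAle first_diff_ge0 andbT; apply/eqP => /esym.
by move=> /first_diff_eq0.
Qed.

End first_diff_semimetric.

(** * Entropy estimates *)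

Section entropy_bounds.
Variables (R : realType) (d : measure_display) (X : measurableType d).
Variables (mu : probability X R) (rho : X -> X -> R).
Implicit Types (eps c : R) (k m : nat).

Lemma eps_entropy_le eps k : (0 < k)%N -> eps_decomposition mu rho eps k ->
  (eps_entropy mu rho eps <= (ln k%:R / ln 2)%:E)%E.
Proof.
move=> k0 dk; rewrite /eps_entropy; case: pselect => [kP|[]]; last first.
  by exists k; apply/asboolP.
case: ex_minnP => m /asboolP[m0 _] /(_ k) mk.
rewrite lee_fin ler_pM2r ?invr_gt0 ?ln_gt0 ?ltr1n//.
rewrite ler_ln ?posrE ?ltr0n// ler_nat; apply: mk; exact/asboolP.
Qed.

Lemma eps_entropy_ge eps c :
  (forall k, (0 < k)%N -> eps_decomposition mu rho eps k -> c <= ln k%:R / ln 2) ->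
  (c%:E <= eps_entropy mu rho eps)%E.
Proof.
move=> h; rewrite /eps_entropy; case: pselect => [kP|_]; last exact: leey.
by case: ex_minnP => m /asboolP[m0 dm] _; rewrite lee_fin h.
Qed.

Lemma ln_natX_div (e : nat) : ln ((2 ^ e)%N%:R : R) / ln 2 = e%:R.
Proof.
rewrite natrX lnXn// -[ln 2 *+ e]mulr_natl mulfK//.
by rewrite gt_eqF// ln_gt0// ltr1n.
Qed.

(** The cells are the fibres of the label in [G], and the exceptional cell is the null complement;
    the gap between [e] and [eps] keeps the diameters strictly below [eps]. *)
Lemma eps_entropy_label (L : finType) (lab : X -> L) (G : set X) eps e m :
  measurable G -> mu (~` G) = 0%E ->
  (forall w, measurable (G `&` [set x | lab x = w])) ->
  0 < eps -> e < eps ->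
  (forall x y, G x -> G y -> lab x = lab y -> rho x y <= e) ->
  (0 < #|L|)%N -> (#|L| <= 2 ^ m)%N ->
  (eps_entropy mu rho eps <= m%:R%:E)%E.
Proof.
move=> mG G0 mlab eps0 e_eps rho_lab L0 Lm.
apply: le_trans (_ : _ <= (ln #|L|%:R / ln 2)%:E)%E _; last first.
  rewrite lee_fin -(ln_natX_div m) ler_pM2r ?invr_gt0 ?ln_gt0 ?ltr1n//.
  by rewrite ler_ln ?posrE ?ltr0n ?ler_nat// expn_gt0.
apply: eps_entropy_le => //.
exists (fun i : 'I_(#|L|).+1 => if unlift ord0 i is Some j
  then G `&` [set x | lab x = enum_val j] else ~` G); split.
- by move=> i; case: unliftP => [j|] _ //; exact: measurableC.
- apply/seteqP; split => // x _; have [Gx|Gx] := pselect (G x); last first.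
    by exists ord0 => //; rewrite unlift_none.
  exists (lift ord0 (enum_rank (lab x))) => //; rewrite liftK.
  by split => //=; rewrite enum_rankK.
- by rewrite unlift_none G0 lte_fin.
- move=> i; case: unliftP => [j|->]; last by rewrite eqxx.
  move=> _ _; apply: (@le_lt_trans _ _ e%:E); last by rewrite lte_fin.
  apply: ge_ereal_sup => _ [[x y] [[/= Gx xj] [/= Gy yj]] <-].
  by rewrite lee_fin rho_lab// xj yj.
Qed.

(** Cells of measure at most [1 / N] must cover more than 3/4 of the space, so [k] exceeds
    [3 / 4 * N]. With [N >= 2] this gives [N <= k ^ 2], hence [2 ^ m <= k ^ 8] and the divisor 8. *)
Lemma eps_entropy_packing eps N m :
  eps <= 4^-1 -> (0 < m)%N -> (2 ^ m <= N ^ 4)%N ->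
  (forall A : set X, measurable A -> (diam rho A < eps%:E)%E ->
     (mu A *+ N <= 1)%E) ->
  ((m%:R / 8)%:E <= eps_entropy mu rho eps)%E.
Proof.
move=> eps4 m0 mN muA; apply: eps_entropy_ge => k k0 [F [mF FT F0 Fd]].
have N2 : (1 < N)%N.
  rewrite ltnNge; apply/negP => N1; have : (N ^ 4 <= 1 ^ 4)%N by rewrite leq_exp2r.
  rewrite exp1n => /(leq_trans mN); rewrite leqNgt => /negP; apply.
  by rewrite -[X in (X < _)%N](expn0 2) ltn_exp2l.
have muF i : mu (F i) = (fine (mu (F i)))%:E.
  by rewrite fineK// fin_num_measure.
have sum1 : 1 <= \sum_(i < k.+1) fine (mu (F i)).
  rewrite -lee_fin -sumEFin.
  under eq_bigr do rewrite -muF.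
  rewrite -(probability_setT mu) -FT.
  have -> : \bigcup_i F i = \big[setU/set0]_(i < k.+1) F (inord i).
    rewrite -(bigcup_mkord k.+1 (fun i => F (inord i))); apply/seteqP.
    split => x [i _ Fx]; last by exists (inord i).
    by exists i => //=; rewrite inord_val.
  apply: le_trans (Boole_inequality mu (fun i _ => mF (inord i))) _.
  by apply: lee_sum => i _; rewrite inord_val.
have F0' : fine (mu (F ord0)) < 4^-1.
  by apply: lt_le_trans eps4; rewrite -lte_fin -muF.
have Fi i : fine (mu (F (lift ord0 i))) <= N%:R^-1.
  have h : (mu (F (lift ord0 i)) *+ N <= 1)%E by apply: muA => //; exact: Fd.
  rewrite muF -EFin_natmul lee_fin -[leLHS]mulr_natr in h.
  by rewrite -[leRHS]mul1r ler_pdivlMr ?ltr0n ?(ltnW N2).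
have kN : 3 / 4 * N%:R < k%:R :> R.
  have : 1 < 4^-1 + k%:R * N%:R^-1 :> R.
    apply: le_lt_trans sum1 _; rewrite big_ord_recl ltr_leD//.
    apply: le_trans (ler_sum _ (fun i _ => Fi i)) _.
    by rewrite sumr_const card_ord [leRHS]mulr_natl.
  rewrite -ltrBlDl ltr_pdivlMr ?ltr0n ?(ltnW N2)//.
  lra.
have k2 : (1 < k)%N.
  have N2' : 2 <= N%:R :> R by rewrite ler_nat.
  by rewrite -(ltr_nat R); lra.
have Nk2 : (N <= k ^ 2)%N.
  rewrite -(ler_nat R) natrX expr2.
  have k2' : 2 <= k%:R :> R by rewrite ler_nat.
  by nra.
have mk8 : (2 ^ m <= k ^ 8)%N.
  by apply: leq_trans mN _; rewrite (expnM k 2 4) leq_exp2r.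
have ln20 : 0 < ln 2 :> R by rewrite ln_gt0// ltr1n.
rewrite ler_pdivlMr// mulrAC ler_pdivrMr//.
rewrite !mulr_natr mulr_natl -!lnXn ?ltr0n// -!natrX.
by rewrite ler_ln ?posrE ?ltr0n ?expn_gt0 ?k0// ler_nat.
Qed.

End entropy_bounds.

(** * Lower bound for the entropy of the odometer extension *)

Section odometer_lower.
Variables (R : realType) (S : nat -> pred nat) (j : nat).
Local Notation X := (borel_bits R (nat * nat)%type).
Local Notation coin := (coin R (nat * nat)%type).
Local Notation rho := (@first_diff R (nat * nat)%type : X -> X -> R).
Local Notation T := (odometer S : X -> X).

Section twist.
Variable N : nat.

Let l := count (S j) (iota 0 N).
Let sites := [seq k <- iota 0 N | S j k].

Let size_sites : size sites = l.
Proof. by rewrite size_filter. Qed.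

Let restrict (e : nat) : {ffun 'I_l -> bool} :=
  [ffun m : 'I_l => Nat.testbit e (nth 0%N sites m)].

(** A codeword [v] assigns a bit to each subset of the digits of [S j] below [N], and flips z_j at
    [e] according to the trace of [e] on them. This preserves the measure and the odometer
    digits. *)
Definition twist (v : {ffun {ffun 'I_l -> bool} -> bool}) (i : nat * nat) : bool :=
  if i is (j'.+1, e) then (j' == j) && v (restrict e) else false.

Let twisted v (x : X) : X := fun i => x i (+) twist v i.

Let num_twisted v M x : num M (twisted v x) = num M x.
Proof. by apply: eq_bigr => k _; rewrite /twisted addbF. Qed.

Let aperiodic_twisted v x : aperiodic x -> aperiodic (twisted v x).
Proof.
by move=> ax M; have [k Mk xk] := ax M; exists k => //; rewrite /twisted addbF.
Qed.

Let twisted_iter v x t D : aperiodic x ->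
  (forall k, Nat.testbit D k = S j k && (bit k t (+) carried x t k)) ->
  iter t T (twisted v x) (j.+1, 0%N) = x (j.+1, D) (+) v (restrict D).
Proof.
move=> ax Db.
have [D' [Db' De]] := iter_sections S t j (aperiodic_twisted v ax).
have -> : D = D'.
  by apply: testbit_inj => k; rewrite Db Db' /carried num_twisted.
by rewrite De PeanoNat.Nat.lxor_0_l /twisted /= eqxx.
Qed.

(** Up to flips depending on [x] alone, the trace of [D t] consists of the digits of [num N x + t]
    in [S j]. This number runs through all residues modulo [2 ^ N], so every pattern is visited
    equally often. *)
Let sum_restrict x (D : nat -> nat) (V : {ffun 'I_l -> bool}) :
  (forall t k, Nat.testbit (D t) k = S j k && (bit k t (+) carried x t k)) ->
  (\sum_(0 <= t < 2 ^ N) (restrict (D t) == V) = 2 ^ (N - l))%N.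
Proof.
move=> Db; pose b k := if insub (index k sites) is Some m then V m else false.
pose good s := all (fun k => S j k ==> (bit k s == b k (+) x (0%N, k))) (iota 0 N).
transitivity (\sum_(0 <= t < 2 ^ N) good ((num N x + t) %% 2 ^ N))%N.
  apply: eq_big_nat => t _; congr nat_of_bool.
  have DE k : (k < N)%N -> S j k -> Nat.testbit (D t) k =
      bit k ((num N x + t) %% 2 ^ N) (+) x (0%N, k).
    move=> kN Sk; rewrite bit_modX// bit_add bit_num// Db Sk /=.
    rewrite /carried /carry (num_mod x (ltnW kN)).
    by case: (x _); case: (bit k t); case: (_ <= _)%N.
  apply/eqP/allP => [VE k|h].
    rewrite mem_iota /= add0n => kN; apply/implyP => Sk.
    have ks : k \in sites by rewrite mem_filter Sk mem_iota.
    have il : (index k sites < l)%N by rewrite -size_sites index_mem.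
    have := DE _ kN Sk; rewrite /b insubT -VE ffunE /= nth_index// => ->.
    by rewrite addbK.
  apply/ffunP => m; rewrite ffunE.
  have ms : (m < size sites)%N by rewrite size_sites.
  have := mem_nth 0%N ms; set k := nth _ _ _ => ks.
  have := ks; rewrite mem_filter mem_iota /= => /andP[Sk kN].
  have /h : k \in iota 0 N by rewrite mem_iota.
  rewrite Sk /= DE// => /eqP ->; rewrite addbK /b.
  have us : uniq sites by rewrite filter_uniq// iota_uniq.
  by rewrite /k index_uniq// valK.
rewrite (sum_mod_shift (fun s => nat_of_bool (good s)))?expn_gt0//.
rewrite sum_bits_eq; congr (2 ^ _)%N.
have := count_predC (S j) (iota 0 N); rewrite size_iota -/l => {2}<-.
by rewrite addKn.
Qed.

Let l_le_N : (l <= N)%N.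
Proof. by rewrite -[leqRHS](size_iota 0) count_size. Qed.

(** At time [t] the orbits differ at [(j.+1, 0)] exactly when the codewords differ at the trace of
    [D t]. By equidistribution this happens for more than 1/8 of the first [2 ^ N] times, and
    [n < 2 ^ N.+1] costs another factor 2: hence 16. *)
Lemma averaged_twisted n v w (x : X) : (2 ^ N <= n < 2 ^ N.+1)%N ->
  (2 ^ l < 8 * hamming v w)%N -> aperiodic x ->
  weight R (j.+1, 0%N) / 16 <= averaged T rho n (twisted v x) (twisted w x).
Proof.
move=> /andP[Nn nN] vw ax.
have /choice[D Db] : forall t, exists D, forall k,
    Nat.testbit D k = S j k && (bit k t (+) carried x t k).
  by move=> t; have [D [Db _]] := iter_sections S t j ax; exists D.
set c := weight _ _; have c0 : 0 < c by exact: weight_gt0.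
have rho_ge t : c * (v (restrict (D t)) != w (restrict (D t)))%:R <=
    rho (iter t T (twisted v x)) (iter t T (twisted w x)).
  case: eqP => [_|vwt]; first by rewrite mulr0 first_diff_ge0.
  rewrite mulr1; apply: weight_le_first_diff.
  rewrite (twisted_iter _ ax (Db t)) (twisted_iter _ ax (Db t)).
  by move=> /(can_inj (addKb _)).
have sumE : (\sum_(0 <= t < 2 ^ N) (v (restrict (D t)) != w (restrict (D t))) =
    2 ^ (N - l) * hamming v w)%N.
  transitivity (\sum_(0 <= t < 2 ^ N) \sum_V
      ((restrict (D t) == V) * (v V != w V)))%N.
    apply: eq_bigr => t _; rewrite (bigD1 (restrict (D t)))//= eqxx mul1n.
    by rewrite big1 ?addn0// => V /negbTE; rewrite eq_sym => ->.
  rewrite exchange_big /= big_distrr /=; apply: eq_bigr => V _.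
  by rewrite -big_distrl /= (sum_restrict _ Db).
have n0 : (0 < n)%N by apply: leq_trans Nn; rewrite expn_gt0.
rewrite /averaged [leRHS]mulrC ler_pdivlMr ?ltr0n//.
pose dist t := rho (iter t T (twisted v x)) (iter t T (twisted w x)).
apply: (@le_trans _ _ (\sum_(t < 2 ^ N) dist t)); last first.
  rewrite -!(big_mkord xpredT dist).
  rewrite [leRHS](big_cat_nat (n := (2 ^ N)%N))//= lerDl sumr_ge0// => t _.
  exact: first_diff_ge0.
apply: le_trans (ler_sum _ (fun t _ => rho_ge _)).
rewrite -mulr_sumr -mulrA ler_pM2l//.
rewrite -(big_mkord xpredT (fun t => (v (restrict (D t)) != w (restrict (D t)))%:R)).
rewrite -natr_sum sumE.
rewrite ler_pdivrMl// -natrM ler_nat.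
have : (2 ^ N <= 2 ^ (N - l) * (8 * hamming v w))%N.
  by rewrite -{1}(subnK l_le_N) expnD leq_mul2l ltnW ?orbT.
move: nN; rewrite expnS; lia.
Qed.

(** A common aperiodic point of two preimages of [A] under twists would give two points of [A] too
    far apart. So there are [#|C|] disjoint sets with the measure of [A]. *)
Lemma twisted_packing n (A : set X) (C : {set {ffun {ffun 'I_l -> bool} -> bool}}) :
  (2 ^ N <= n < 2 ^ N.+1)%N ->
  {in C &, forall v w, v != w -> (2 ^ l < 8 * hamming v w)%N} ->
  measurable A ->
  (diam (averaged T rho n) A < (weight R (j.+1, 0%N) / 16)%:E)%E ->
  (coin A *+ #|C| <= 1)%E.
Proof.
move=> Nn Csep mA dA.
pose A' := A `&` [set x : X | aperiodic x].
have mA' : measurable A' by apply: measurableI => //; exact: measurable_aperiodic.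
pose B (i : 'I_#|C|) : set X := twisted (enum_val i) @^-1` A'.
have BE i : coin (B i) = coin A.
  transitivity (coin A').
    exact: (coin_permute (sigma := id) (twist (enum_val i)) (fun _ _ => id) mA').
  apply/eqP; rewrite eq_le; apply/andP; split.
    by apply: le_measure; rewrite ?inE// => x [].
  have := measurableC (@measurable_aperiodic R) => mN.
  apply: le_trans (_ : coin (A' `|` ~` [set x : X | aperiodic x]) <= _)%E.
    apply: le_measure; rewrite ?inE//; first exact: measurableU.
    by move=> x Ax; have [ax|ax] := pselect (aperiodic x); [left|right].
  apply: le_trans (measureU2 coin mA' mN) _.
  by rewrite [X in (_ + X)%E](coin_aperiodicC R) adde0.
have mB i : measurable (B i).
  rewrite -[X in measurable X]setTI.
  by apply: (@measurable_permute R id (twist (enum_val i))).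
have tB : trivIset setT B.
  apply/trivIsetP => i i' _ _ ii'; apply/seteqP; split => // x [[Ax ax] [Ax' _]].
  have ax0 : aperiodic x.
    by move=> M; have [k Mk] := ax M; rewrite /twisted addbF; exists k.
  have vw : enum_val i != enum_val i' by rewrite (inj_eq enum_val_inj).
  have := averaged_twisted Nn (Csep _ _ (enum_valP i) (enum_valP i') vw) ax0.
  rewrite leNgt => /negP; apply; rewrite -lte_fin; apply: le_lt_trans dA.
  by apply: ereal_sup_ubound; exists (twisted (enum_val i) x, twisted (enum_val i') x).
have mU : measurable (\big[setU/set0]_(i < #|C|) B i).
  by apply: bigsetU_measurable => i _.
have := probability_le1 coin mU.
rewrite (@measure_bigsetU_ord _ _ _ coin _ xpredT B mB tB).
by rewrite (eq_bigr (fun=> coin A)) ?sumr_const ?card_ord// => i _; exact: BE.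
Qed.

End twist.

Lemma odometer_entropy_ge : exists2 delta : R, 0 < delta &
  forall n N, (2 ^ N <= n < 2 ^ N.+1)%N ->
    (((2 ^ count (S j) (iota 0 N))%N%:R / 8)%:E <=
     eps_entropy coin (averaged T rho n) delta)%E.
Proof.
pose w := weight R (j.+1, 0%N); have w0 : 0 < w by exact: weight_gt0.
(* The first bound separates the twists; 1/4 is required by [eps_entropy_packing]. *)
exists (Num.min (w / 16) 4^-1); first by rewrite lt_min invr_gt0 ltr0n andbT divr_gt0 ?ltr0n.
move=> n N Nn.
have [C [CE Csep]] := exists_code {ffun 'I_(count (S j) (iota 0 N)) -> bool}.
rewrite card_ffun card_bool card_ord in CE Csep.
apply: (eps_entropy_packing _ _ CE); rewrite ?expn_gt0//.
  by rewrite ge_min lexx orbT.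
move=> A mA dA; apply: (twisted_packing Nn Csep mA).
by apply: lt_le_trans dA _; rewrite lee_fin ge_min lexx.
Qed.

End odometer_lower.

(** * Upper bound for the entropy of the odometer extension *)

Lemma sum_geometric_le (F : nat -> nat) M l :
  (forall k, (k < l)%N -> (2 ^ k * F k <= M)%N) ->
  (\sum_(0 <= k < l) F k <= 2 * M)%N.
Proof.
(* The induction keeps the remainder of the geometric series: the sum is at most
   [2 * M * (1 - 2 ^ -l)]. *)
move=> FM; suff : (2 ^ l * \sum_(0 <= k < l) F k + 2 * M <= 2 * (2 ^ l * M))%N.
  have := expn_gt0 2 l; rewrite /= => l0 h.
  rewrite -(leq_pmul2l l0); apply: leq_trans (_ : _ <= 2 * (2 ^ l * M))%N _; lia.
elim: l FM => [|l IH] FM; first by rewrite big_geq// expn0; lia.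
have := FM l (ltnSn l); have := IH (fun k kl => FM k (ltnW kl)).
rewrite big_nat_recr//= expnS mulnDr; set s := \sum_(_ <= _ < _) _.
move: (2 ^ l)%N s (F l) => p s f; nia.
Qed.

(** Serves to absorb the quadratically many bits of the slices in a label into [2 ^ l]. *)
Lemma sqr_le_expn (l : nat) : (l * l + 2 * l + 3 <= 3 * 2 ^ l)%N.
Proof. by elim: l => // l IH; rewrite expnS; move: (2 ^ l)%N IH => p; nia. Qed.

Section odometer_upper.
Variables (R : realType) (S : nat -> pred nat).
Local Notation X := (borel_bits R (nat * nat)%type).
Local Notation coin := (coin R (nat * nat)%type).
Local Notation rho := (@first_diff R (nat * nat)%type : X -> X -> R).
Local Notation T := (odometer S : X -> X).

Lemma first_diff_le_square (e : R) : 0 < e -> exists q : nat, forall x y : X,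
  (forall a b, (a < q)%N -> (b < q)%N -> x (a, b) = y (a, b)) -> rho x y <= e.
Proof.
move=> e0; have [K Ke] := @pickle_weight_lt R (nat * nat)%type e e0.
exists (\max_(c <- pmap (@unpickle (nat * nat)%type) (iota 0 K)) maxn c.1 c.2).+1.
move=> x y xy; apply: first_diff_le => [|[a b] ew]; first exact: ltW.
have ab : (a, b) \in pmap (@unpickle (nat * nat)%type) (iota 0 K).
  rewrite mem_pmap; apply/mapP; exists (pickle (a, b)); last by rewrite pickleK.
  rewrite mem_iota /= add0n ltnNge; apply/negP => /Ke.
  by rewrite ltNge (ltW ew).
have : (maxn (a, b).1 (a, b).2 <= \max_(c <- pmap (@unpickle (nat * nat)%type)
    (iota 0 K)) maxn c.1 c.2)%N by apply: leq_bigmax_seq.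
rewrite geq_max => /andP[aq bq].
by apply: xy; rewrite ltnS.
Qed.

Section label.
(** The metric is controlled, up to a small error, by the coordinates in the square of side [q];
    [2 ^ N] is the window length and [C] the extra precision of the recorded leading digits. *)
Variables q C N l : nat.
Hypothesis qN : (q <= N)%N.
Hypothesis Sl : forall j, (j < q)%N -> (count (S j) (iota 0 N) <= l)%N.

Let sites j := [seq k <- iota 0 N | S j k].

Let low j (V : {ffun 'I_l -> bool}) : nat := bitset (fun k => S j k &&
  (if insub (index k (sites j)) is Some m then V m else false)) N.

(** A carry leaving the first [N] digits stops at the first zero from [N] on; the default 0 only
    concerns points that are not aperiodic. *)
Let top (x : X) : nat :=
  if first (fun k => (N <= k)%N && ~~ x (0%N, k)) is Some i then i.+1 else 0%N.

(* The digits in S j changed by the only carry that can leave the first N digits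
   before time 2 ^ N. *)
Let high j (x : X) : nat := bitset (fun k => S j k && (N <= k)%N) (top x).

(* The c leading digits of the odometer modulo 2 ^ i. *)
Let slice c i (x : X) : nat := (num i x %/ 2 ^ (i - c))%N.

(** By [displacement], these are the coordinates that z_j at [e] can read before time [2 ^ N]; [b]
    tells whether the carry has left the first [N] digits. *)
Let window (x : X) (p : 'I_q * 'I_q * {ffun 'I_l -> bool} * bool) : nat * nat :=
  let: (j, e, V, b) := p in
  (j.+1, Nat.lxor e (Nat.lxor (low j V) (if b then high j x else 0%N))).

Let label_type : finType :=
  ({ffun 'I_q * 'I_q * {ffun 'I_l -> bool} * bool -> bool} *
   {ffun 'I_q * 'I_l -> 'I_(2 ^ (l + C)).+1} *
   ('I_(2 ^ C).+1 * 'I_(2 ^ q).+1))%type.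

(** The site of rank [p] is recorded to precision [p + C], so that the proportion of times with
    differing carries decays geometrically in [p], while about [l * (l + C)] bits are spent for each
    [j]. The values fit their ordinal types, so [inord] loses nothing. *)
Let label (x : X) : label_type :=
  ([ffun p => x (window x p)],
   [ffun p : 'I_q * 'I_l => inord (slice (p.2 + C) (nth 0%N (sites p.1) p.2) x)],
   (inord (slice C N x), inord (num q x))).

Lemma card_label_gt0 : (0 < #|label_type|)%N.
Proof. by apply/card_gt0P; exists (label (fun=> false)). Qed.

Lemma card_label_le :
  (#|label_type| <= 2 ^ ((2 * q * q + q * (C + 4) + C + q + 2) * 2 ^ l))%N.
Proof.
rewrite !card_prod !card_ffun !card_prod !card_ffun !card_bool !card_ord.
have S2 m : ((2 ^ m).+1 <= 2 ^ m.+1)%N by rewrite expnS; have := expn_gt0 2 m; lia.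
apply: leq_trans (_ : _ <= 2 ^ (q * q * 2 ^ l * 2) * (2 ^ (l + C).+1) ^ (q * l) *
    (2 ^ C.+1 * 2 ^ q.+1))%N _.
  by rewrite leq_mul ?leq_mul//; case: (posnP (q * l)%N) => [->//|?]; rewrite leq_exp2r.
rewrite -expnM -!expnD leq_exp2l//.
have := sqr_le_expn l; have : (0 < 2 ^ l)%N by rewrite expn_gt0.
have := ltn_expl l (isT : (1 < 2)%N); move: (2 ^ l)%N => p lp p0 llp.
have h1 : (q * (l * l + l) <= q * (3 * p))%N by rewrite leq_mul2l; lia.
have h2 : (q * C * l <= q * C * p)%N by rewrite leq_mul2l (ltnW lp) orbT.
have h3 : (C + q + 2 <= (C + q + 2) * p)%N by rewrite leq_pmulr.
lia.
Qed.

Let slice_lt c i x : (slice c i x < (2 ^ c).+1)%N.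
Proof.
rewrite ltnS /slice ltnW// ltn_divLR ?expn_gt0// -expnD.
by apply: leq_trans (num_lt i x) _; rewrite leq_exp2l//; lia.
Qed.

Let inord_slice_inj c M i x y : (c <= M)%N ->
  inord (slice c i x) = inord (slice c i y) :> 'I_(2 ^ M).+1 ->
  slice c i x = slice c i y.
Proof.
move=> cM /(congr1 val) /=; have le2 z : (slice c i z < (2 ^ M).+1)%N.
  by apply: leq_trans (slice_lt c i z) _; rewrite ltnS leq_exp2l.
by rewrite !inordK.
Qed.

Let carriedE i x t : (i <= N)%N -> carried x t i = carry i (num N x) t.
Proof. by move=> iN; rewrite /carried /carry num_mod. Qed.

Let clash x y t i : bool := carried x t i != carried y t i.

Let sum_clash c i x y : (i <= N)%N -> slice c i x = slice c i y ->
  (2 ^ c * \sum_(0 <= t < 2 ^ N) clash x y t i <= 2 ^ N)%N.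
Proof.
move=> iN xy; under eq_bigr do rewrite /clash !carriedE//.
by apply: sum_carry_neq; rewrite // !num_mod.
Qed.

Let bad x y t : bool := clash x y t N ||
  has (fun j => has (clash x y t) (sites j)) (iota 0 q).

(** By [sum_carry_neq] the carries at the site of rank [k] differ for a proportion at most
    [2 ^ -(k + C)] of the window. The sites of each [j] sum to at most [2 * 2 ^ -C], and the carry
    out of the first [N] digits adds [2 ^ -C]. *)
Let bad_sum x y : label x = label y ->
  (2 ^ C * \sum_(0 <= t < 2 ^ N) bad x y t <= 2 ^ N * (1 + 2 * q))%N.
Proof.
case=> _ /ffunP sl /inord_slice_inj slN _.
have has_le (I : Type) (s : seq I) (p : pred I) : (has p s <= \sum_(i <- s) p i)%N.
  by elim: s => [|i s IH] /=; rewrite ?big_nil ?big_cons//; case: (p i).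
have size_sites j : (j < q)%N -> (size (sites j) <= l)%N.
  by move=> jq; rewrite size_filter Sl.
apply: leq_trans (_ : _ <= 2 ^ C * \sum_(0 <= t < 2 ^ N) clash x y t N +
    \sum_(j <- iota 0 q) 2 ^ C * \sum_(i <- sites j) \sum_(0 <= t < 2 ^ N) clash x y t i)%N _.
  rewrite -big_distrr -mulnDr leq_mul2l; apply/orP; right.
  under [X in (_ <= _ + X)%N]eq_bigr do rewrite exchange_big.
  rewrite [X in (_ <= _ + X)%N]exchange_big -big_split /=; apply: leq_sum => t _.
  rewrite /bad; case: (clash x y t N) => //=.
  apply: leq_trans (has_le _ _ _) _; apply: leq_sum => j _; exact: has_le.
rewrite mulnDr muln1 leq_add//; first by apply: sum_clash => //; exact: slN.
apply: leq_trans (_ : _ <= \sum_(j <- iota 0 q) 2 * 2 ^ N)%N _; last first.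
  by rewrite big_const_seq count_predT size_iota iter_addn_0; lia.
rewrite big_seq [leqRHS]big_seq; apply: leq_sum => j; rewrite mem_iota /= add0n => jq.
rewrite (big_nth 0%N) big_distrr /=; apply: sum_geometric_le => k ks.
have kl : (k < l)%N by apply: leq_trans ks (size_sites j jq).
rewrite mulnA -expnD; apply: sum_clash.
  have := mem_nth 0%N ks; rewrite mem_filter mem_iota /= => /andP[_].
  by rewrite add0n => /ltnW.
have := sl (Ordinal jq, Ordinal kl); rewrite !ffunE /=; apply: inord_slice_inj.
by rewrite leq_add2r ltnW.
Qed.

Let pattern_of j D : {ffun 'I_l -> bool} := [ffun m : 'I_l =>
  (m < size (sites j))%N && Nat.testbit D (nth 0%N (sites j) m)].

(** Below [N] the set [D] is recovered from its pattern. From [N] on [t] has no digits, so only the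
    carry contributes, and it runs up to the first zero. *)
Let displacement x t j D : aperiodic x -> (t < 2 ^ N)%N -> (j < q)%N ->
  (forall k, Nat.testbit D k = S j k && (bit k t (+) carried x t k)) ->
  D = Nat.lxor (low j (pattern_of j D))
    (if carried x t N then high j x else 0%N).
Proof.
move=> ax tN jq Db; apply: testbit_inj => k.
rewrite testbit_lxor testbit_bitset.
have [kN|Nk] := ltnP k N.
  have -> : Nat.testbit (if carried x t N then high j x else 0%N) k = false.
    case: ifP => _; last exact: PeanoNat.Nat.bits_0.
    by rewrite testbit_bitset leqNgt kN andbF.
  rewrite andbT addbF [LHS]Db; case Sk: (S j k) => //=.
  have ks : k \in sites j by rewrite mem_filter Sk mem_iota.
  have il : (index k (sites j) < l)%N.
    by apply: leq_trans (Sl jq); rewrite -size_filter index_mem.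
  by rewrite insubT ffunE /= index_mem ks nth_index// Db Sk.
rewrite andbF /= Db bit_small; last by apply: leq_trans tN _; rewrite leq_exp2l.
rewrite (carried_high _ tN Nk); case: (carried x t N); last first.
  by rewrite PeanoNat.Nat.bits_0 andbF.
rewrite testbit_bitset Nk andbT /= /top; congr andb.
case: firstP => [i /andP[Ni xi] imin|h]; last first.
  by have [i Ni xi] := ax N; have := h i; rewrite Ni xi.
apply/allP/idP => [h|ki i'].
  rewrite ltnNge; apply/negP => ik; have := h i; rewrite mem_iota subnKC// Ni ik.
  by move=> /(_ isT); rewrite (negbTE xi).
rewrite mem_iota subnKC// => /andP[Ni' i'k].
by have := imin i' (leq_trans i'k ki); rewrite Ni' negbK.
Qed.

(** Outside the bad times the carries coincide, hence so do the patterns, and both orbits read the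
    same entry of the label; the odometer digits below [q] follow from [num q]. *)
Let good_agree x y t : aperiodic x -> aperiodic y -> label x = label y ->
  (t < 2 ^ N)%N -> ~~ bad x y t ->
  forall a b, (a < q)%N -> (b < q)%N ->
  iter t T x (a, b) = iter t T y (a, b).
Proof.
move=> ax ay lxy tN; rewrite negb_or negbK => /andP[/eqP cN /hasPn cS].
have [win _ _ /(congr1 val) /= numq] := lxy.
have lt2 z : (num q z < (2 ^ q).+1)%N by rewrite ltnS ltnW// num_lt.
rewrite !inordK// in numq.
move=> [|j] b jq bq.
  rewrite !iter_digit// /carried -!(bit_num _ bq) numq.
  by rewrite -!(num_mod _ (ltnW bq)) numq.
have {}jq := ltnW jq.
have [D [Db ->]] := iter_sections S t j ax.
have [D' [Db' ->]] := iter_sections S t j ay.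
rewrite (displacement ax tN jq Db) (displacement ay tN jq Db') cN.
have -> : pattern_of j D = pattern_of j D'.
  apply/ffunP => m; rewrite !ffunE Db Db'.
  have [ms|//] := ltnP m (size (sites j)).
  have /cS : j \in iota 0 q by rewrite mem_iota.
  by move=> /hasPn/(_ _ (mem_nth 0%N ms)); rewrite negbK => /eqP ->.
move/ffunP : win => /(_ (Ordinal jq, Ordinal bq, pattern_of j D', carried y t N)).
by rewrite !ffunE.
Qed.

(** The label depends only on the digits up to the first zero from [N] on and on finitely many
    coordinates given by [window]. Its fibres are thus relatively open, which makes them
    measurable. *)
Let locally_constant x : (exists2 k, (N <= k)%N & ~~ x (0%N, k)) ->
  exists s, forall y, cyl R s x y ->
    label y = label x /\ exists2 k, (N <= k)%N & ~~ y (0%N, k).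
Proof.
move=> [k0 Nk0 xk0].
have [i topx [Ni [xi imin]]] : exists2 i, top x = i.+1 & (N <= i)%N /\ (~~ x (0%N, i) /\
    forall k, (k < i)%N -> ~~ ((N <= k)%N && ~~ x (0%N, k))).
  rewrite /top; case: firstP => [i /andP[Ni xi] imin|/(_ k0)]; last by rewrite Nk0 xk0.
  by exists i.
exists ([seq (0%N, k) | k <- iota 0 i.+1] ++ [seq window x p | p <- enum predT]).
move=> y xy.
have digit k : (k <= i)%N -> x (0%N, k) = y (0%N, k).
  move=> ki; apply: xy; rewrite mem_cat; apply/orP; left.
  by apply/mapP; exists k; rewrite ?mem_iota.
have topy : top y = top x.
  rewrite topx /top (@first_eq _ i)// -?digit// ?Ni//.
  by move=> k ki; rewrite -digit ?(ltnW ki)// imin.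
have numy M : (M <= N)%N -> num M y = num M x.
  move=> MN; apply: eq_big_nat => k /andP[_ kM]; rewrite digit//.
  by apply: ltnW; apply: leq_trans kM (leq_trans MN Ni).
have windowy p : window y p = window x p.
  by case: p => [[[j e] V] b] /=; rewrite /high topy.
split; last by exists i => //; rewrite -digit.
rewrite /label; congr (_, _, (_, _)).
- apply/ffunP => p; rewrite !ffunE windowy; apply/esym/xy.
  by rewrite mem_cat map_f ?orbT// mem_enum.
- apply/ffunP => p; rewrite !ffunE /slice numy//.
  have [pm|pm] := ltnP p.2 (size (sites p.1)); last by rewrite nth_default.
  have := mem_nth 0%N pm; rewrite mem_filter mem_iota /= => /andP[_].
  by rewrite add0n => /ltnW.
- by rewrite /slice numy.
- by rewrite numy.
Qed.

Let measurable_label w :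
  measurable ([set x : X | aperiodic x] `&` [set x | label x = w]).
Proof.
pose U := [set x : bits R (nat * nat)%type |
  label x = w /\ exists2 k, (N <= k)%N & ~~ x (0%N, k)].
rewrite (_ : _ `&` _ = [set x : X | aperiodic x] `&` U).
  apply: measurableI; first exact: measurable_aperiodic.
  apply: sub_sigma_algebra; apply/open_bitsP => x [xw xN].
  have [s sx] := locally_constant xN; exists s => y /sx[lyx yN].
  by split => //; rewrite lyx.
by apply/seteqP; split => x /= [ax]; [move=> xw; split => //|move=> []].
Qed.

(** Good times contribute at most [eps / 4] to the average, and bad ones, the metric being at most
    1, another [eps / 4] by the choice of [C]; the factor [2 ^ q.+1] pays for a window longer than
    [n]. *)
Lemma odometer_entropy_label eps n : 0 < eps -> (0 < n)%N -> (n <= 2 ^ N)%N ->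
  (2 ^ N <= 2 ^ q.+1 * n)%N ->
  (forall x y : X, (forall a b, (a < q)%N -> (b < q)%N -> x (a, b) = y (a, b)) ->
    rho x y <= eps / 4) ->
  (2 ^ q.+1 * (1 + 2 * q))%N%:R <= eps / 4 * 2 ^+ C ->
  (eps_entropy coin (averaged T rho n) eps <=
    ((2 * q * q + q * (C + 4) + C + q + 2) * 2 ^ l)%N%:R%:E)%E.
Proof.
move=> eps0 n0 nN Nn rhoq qC.
apply: (@eps_entropy_label _ _ _ _ _ _ label [set x : X | aperiodic x] _ (eps / 2));
  rewrite ?card_label_gt0 ?card_label_le//.
- exact: measurable_aperiodic.
- exact: coin_aperiodicC.
- by rewrite ltr_pdivrMr// ltr_pMr// ltr1n.
move=> x y /= ax ay lxy; rewrite /averaged ler_pdivrMl ?ltr0n//.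
have term t : (t < n)%N -> rho (iter t T x) (iter t T y) <= eps / 4 + (bad x y t)%:R.
  move=> tn; case bt : (bad x y t).
    apply: le_trans (first_diff_le1 _ _ _) _; rewrite lerDr.
    by rewrite divr_ge0// ltW.
  rewrite addr0; apply: rhoq; apply: good_agree => //; last by rewrite bt.
  exact: leq_trans tn nN.
apply: (@le_trans _ _ (\sum_(t < n) (eps / 4 + (bad x y t)%:R))).
  by apply: ler_sum => t _; exact: term.
rewrite big_split /= sumr_const card_ord -[_ *+ n]mulr_natl -natr_sum.
have -> : n%:R * (eps / 2) = n%:R * (eps / 4) + n%:R * (eps / 4) by field.
rewrite lerD2l; set B := (\sum_(_ < _) _)%N.
have BN : (2 ^ C * B <= 2 ^ q.+1 * (1 + 2 * q) * n)%N.
  apply: leq_trans (_ : _ <= 2 ^ N * (1 + 2 * q))%N _; last by nia.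
  apply: leq_trans (bad_sum lxy); rewrite leq_mul2l; apply/orP; right.
  rewrite [leqRHS](big_cat_nat (n := n))//= /B.
  rewrite -(big_mkord xpredT (fun t => nat_of_bool (bad x y t))).
  exact: leq_addr.
have C0 : 0 < 2 ^+ C :> R by rewrite exprn_gt0.
rewrite -(ler_pM2l C0) -natrX -natrM; apply: le_trans (_ : _ <= _%:R) _.
  by rewrite ler_nat; exact: BN.
by rewrite natrM [leLHS]mulrC mulrCA ler_pM2l ?ltr0n// natrX [leRHS]mulrC.
Qed.

End label.

Lemma odometer_entropy_le eps : 0 < eps -> exists K q, forall n N l,
  (0 < n)%N -> (q <= N)%N -> (n <= 2 ^ N)%N -> (2 ^ N <= 2 ^ q.+1 * n)%N ->
  (forall j, (j < q)%N -> (count (S j) (iota 0 N) <= l)%N) ->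
  (eps_entropy coin (averaged T rho n) eps <= (K * 2 ^ l)%N%:R%:E)%E.
Proof.
move=> eps0; have eps4 : 0 < eps / 4 by rewrite divr_gt0.
have [q rhoq] := first_diff_le_square eps4.
pose B : R := (2 ^ q.+1 * (1 + 2 * q))%N%:R.
pose C := Num.truncn (B / (eps / 4)).
have qC : B <= eps / 4 * 2 ^+ C.+1.
  rewrite mulrC -ler_pdivrMr//; apply: le_trans (ltW (truncnS_gt _)) _.
  by rewrite -natrX ler_nat ltnW// ltn_expl.
exists (2 * q * q + q * (C.+1 + 4) + C.+1 + q + 2)%N, q => n N l n0 qN nN Nn Sl.
by apply: (@odometer_entropy_label q C.+1 N l qN Sl).
Qed.

End odometer_upper.

(** * Realizing a scaling entropy class *)

Lemma eps_entropy_ge0 (R : realType) (d : measure_display) (X : measurableType d)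
    (mu : probability X R) (rho : X -> X -> R) (eps : R) :
  (0 <= eps_entropy mu rho eps)%E.
Proof.
apply: eps_entropy_ge => k k0 _.
by rewrite divr_ge0 ?ln_ge0 ?ler1n.
Qed.

Lemma averaged1 (R : realType) (X : Type) (T : X -> X) (rho : X -> X -> R) :
  averaged T rho 1 = rho.
Proof.
by apply/funext => x; apply/funext => y; rewrite /averaged big_ord1 invr1 mul1r.
Qed.

Lemma subadditive_mul (R : realType) (f : nat -> R) :
  (forall k m, (0 < k)%N -> (0 < m)%N -> f (k + m)%N <= f k + f m) ->
  forall k n, (0 < k)%N -> (0 < n)%N -> f (k * n)%N <= k%:R * f n.
Proof.
move=> fD [//|k] n _ n0; elim: k => [|k IH]; first by rewrite mul1n mul1r.
rewrite mulSn; apply: le_trans (fD _ _ n0 _) _; first by rewrite muln_gt0.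
by rewrite -[in leRHS]natr1 mulrDl mul1r addrC lerD2r.
Qed.

(** Greedy choice: [N] joins [S] when the doubled approximation still fits below [f (2 ^ N.+1)]. If
    it does, the upper bound persists because [f] at most doubles; if not, the lower bound persists
    by monotonicity. *)
Lemma dyadic_profile (R : realType) (f : nat -> R) : 0 < f 1%N ->
  (forall m n, (0 < m)%N -> (m <= n)%N -> f m <= f n) ->
  (forall k m, (0 < k)%N -> (0 < m)%N -> f (k + m)%N <= f k + f m) ->
  exists S : pred nat, forall N,
    (2 ^ count S (iota 0 N))%N%:R * f 1%N <= f (2 ^ N)%N <
    2 * (2 ^ count S (iota 0 N))%N%:R * f 1%N.
Proof.
move=> f1 fle fD.
pose next (N l : nat) := 2 * (2 ^ l)%N%:R * f 1%N <= f (2 ^ N.+1)%N.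
(* [L N] counts the elements of [S] below [N]; whether [N] belongs to [S] depends on this count, so
   the count is defined first. *)
pose L := fix L N := if N is M.+1 then (L M + next M (L M))%N else 0%N.
exists (fun N => next N (L N)) => N.
have -> : count (fun N => next N (L N)) (iota 0 N) = L N.
  by elim: N => // N IH; rewrite -addn1 iotaD count_cat IH /= addn0 addn1.
elim: N => [|N /andP[IH1 IH2]] /=; first by rewrite mul1r mulr1 ltr_pMl ?ltr1n ?lexx.
have f2 : f (2 ^ N.+1)%N <= 2 * f (2 ^ N)%N.
  by rewrite expnS; apply: subadditive_mul => //; rewrite expn_gt0.
have fS : f (2 ^ N)%N <= f (2 ^ N.+1)%N.
  by apply: fle; rewrite ?expn_gt0// leq_exp2l.
rewrite /next; case: (leP (2 * (2 ^ L N)%N%:R * f 1%N)) => h;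
  rewrite ?addn0 ?addn1.
  have -> : (2 ^ (L N).+1)%N%:R = 2 * (2 ^ L N)%N%:R :> R by rewrite expnS natrM.
  by rewrite h /=; lra.
by rewrite (le_trans IH1 fS).
Qed.

(* When Phi vanishes the system must be a point mass: the scaling entropy of
   odometer S is never zero. *)
Lemma trivial_system (R : realType) (Phi : nat -> R -> R) :
  nonneg_fun Phi -> decreasing_eps Phi ->
  (forall n eps, (0 < n)%N -> 0 < eps -> Phi n eps = 0) ->
  exists (d : measure_display) (X : measurableType d) (mu : probability X R)
      (T : X -> X),
    measure_preserving_system mu T /\ scaling_entropy mu T Phi.
Proof.
move=> Phi_ge0 Phi_decr Phi0.
pose X := borel_bits R (nat * nat)%type; pose pt : X := fun=> false.
have mpt : measurable [set pt].
  pose c n := odflt (0%N, 0%N) (unpickle n).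
  rewrite (_ : [set pt] = [set x : X | forall n, xpredT n -> x (c n) = false]).
    exact: measurable_forall_coord.
  apply/seteqP; split => x /= => [-> //|h]; apply/funext => i.
  by have := h (pickle i) isT; rewrite /c pickleK.
have H0 n eps : 0 < eps ->
    (eps_entropy (dirac pt) (averaged idfun (@first_diff R _ : X -> X -> R) n) eps <= 0)%E.
  move=> eps0; apply: le_trans (@eps_entropy_le _ _ _ _ _ _ 1%N isT _) _; last first.
    by rewrite ln1 mul0r.
  (* The point is a cell of diameter 0 with null complement, so the entropy is the logarithm of
     1. *)
  exists (fun i => if i == ord0 then ~` [set pt] else [set pt]); split.
  - by move=> i; case: ifP => _ //; exact: measurableC.
  - apply/seteqP; split => // x _; have [->|xpt] := pselect (x = pt).
      by exists ord_max.
    by exists ord0.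
  - by rewrite /= diracE memNset ?lte_fin// => /(_ erefl).
  - move=> i /negbTE -> ; apply: (@le_lt_trans _ _ 0%E); last by rewrite lte_fin.
    apply: ge_ereal_sup => _ [[x y] [/= -> ->] <-]; rewrite lee_fin /averaged.
    rewrite big1 ?mulr0// => k _; exact: first_diffxx.
exists _, X, (dirac pt), idfun; split.
  split; first exact: bits_standard_borel.
  by split; [exact: measurable_id|exists idfun; split => //; exact: measurable_id|].
split => //; exists (@first_diff R _ : X -> X -> R).
  split; [exact: first_diff_semimetric| |exact: first_diff_generating|
    exact: first_diff_integrable].
  move=> eps eps0; apply: le_lt_trans (ltry 0).
  by have := H0 1%N eps eps0; rewrite averaged1.
split => eps eps0; exists eps => //; exists 1 => // n n0.
  by rewrite Phi0// mul1e; exact: eps_entropy_ge0.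
by rewrite Phi0// mule0; exact: H0.
Qed.

Theorem theorem3 (R : realType) (Phi : nat -> R -> R)
    (Phi_ge0 : nonneg_fun Phi)
    (Phi_incr : increasing_n Phi)
    (Phi_decr : decreasing_eps Phi)
    (Phi_subadd : subadditive_n Phi) :
  exists (d : measure_display) (X : measurableType d) (mu : probability X R)
      (T : X -> X),
    measure_preserving_system mu T /\ scaling_entropy mu T Phi.
Proof.
(* If [Phi 1] vanishes at every positive scale, subadditivity makes [Phi] vanish. *)
have [[eps0 eps0_gt0 Phi1]|Phi1] := pselect (exists2 eps, 0 < eps & Phi 1%N eps != 0);
    last first.
  apply: trivial_system => // n eps n0 e0; apply/eqP; rewrite eq_le Phi_ge0// andbT.
  have Phi1e : Phi 1%N eps = 0.
    by apply/eqP/negPn/negP => h; apply: Phi1; exists eps.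
  have := subadditive_mul (fun k m k0 m0 => Phi_subadd k m eps k0 m0 e0) n0 (isT : (0 < 1)%N).
  by rewrite muln1 Phi1e mulr0.
(* Starting the scales at [eps0] keeps [Phi 1 (scale j)] at least [Phi 1 eps0], which is positive:
   [dyadic_profile] applies for every [j], with a uniform constant. *)
pose scale j := eps0 / j.+1%:R.
have scale_gt0 j : 0 < scale j by rewrite divr_gt0.
have c0 : 0 < Phi 1%N eps0 by rewrite lt_neqAle eq_sym Phi1 Phi_ge0.
have c_le j : Phi 1%N eps0 <= Phi 1%N (scale j).
  by apply: Phi_decr => //; rewrite ler_pdivrMr// ler_peMr ?ler1n// ltW.
have /choice[S Sspec] : forall j, exists S : pred nat, forall N,
    (2 ^ count S (iota 0 N))%N%:R * Phi 1%N (scale j) <= Phi (2 ^ N)%N (scale j) <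
    2 * (2 ^ count S (iota 0 N))%N%:R * Phi 1%N (scale j).
  move=> j; apply: (@dyadic_profile R (Phi^~ (scale j))).
  - exact: lt_le_trans (c_le j).
  - by move=> m n m0 mn; exact: Phi_incr.
  - by move=> k m k0 m0; exact: Phi_subadd.
pose X := borel_bits R (nat * nat)%type.
pose rho : X -> X -> R := @first_diff R (nat * nat)%type.
exists _, X, (coin R (nat * nat)%type), (odometer S); split; first exact: odometer_system.
have upper eps : 0 < eps -> exists2 delta : R, 0 < delta &
    seq_lesssim (fun n => eps_entropy (coin R (nat * nat)%type)
      (averaged (odometer S : X -> X) rho n) eps) (fun n => (Phi n delta)%:E).
  move=> e0; have [K [q H]] := odometer_entropy_le S e0.
  (* Only the sets [S j] with [j < q] matter, and [scale q] is finer than all their scales. *)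
  exists (scale q) => //.
  exists (K.+1%:R * (2 ^ q.+1)%N%:R / Phi 1%N eps0).
    by rewrite divr_gt0// mulr_gt0// ltr0n expn_gt0.
  (* The window must have [N >= q]; together with rounding [n] up to a power of 2 this costs a
     factor at most [2 ^ q.+1]. *)
  move=> n n0; pose N := maxn q (trunc_log 2 n).+1.
  pose l := (\max_(j < q) count (S j) (iota 0 N))%N.
  have /andP[tn nt] : (2 ^ trunc_log 2 n <= n < 2 ^ (trunc_log 2 n).+1)%N.
    exact: trunc_log_bounds.
  have nN : (n <= 2 ^ N)%N.
    by apply: leq_trans (ltnW nt) _; rewrite leq_exp2l// leq_maxr.
  have Nn : (2 ^ N <= 2 ^ q.+1 * n)%N.
    have q0 : (0 < 2 ^ q)%N by rewrite expn_gt0.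
    by rewrite /N /maxn; case: ifP => _; rewrite !expnS; nia.
  apply: le_trans (H n N l n0 (leq_maxl _ _) nN Nn _) _.
    by move=> j jq; exact: (leq_bigmax (Ordinal jq)).
  rewrite -EFinM lee_fin natrM -mulrA -mulrA ler_pM ?ler_nat//.
  suff : (2 ^ l)%N%:R * Phi 1%N eps0 <= (2 ^ q.+1)%N%:R * Phi n (scale q).
    by rewrite [X in _ -> _ <= X]mulrAC ler_pdivlMr.
  have qn : Phi (2 ^ N)%N (scale q) <= (2 ^ q.+1)%N%:R * Phi n (scale q).
    apply: le_trans (Phi_incr _ _ _ _ Nn (scale_gt0 q)) _; first by rewrite expn_gt0.
    apply: (@subadditive_mul R (Phi^~ (scale q))) => //; last by rewrite expn_gt0.
    by move=> k m k0 m0; exact: Phi_subadd.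
  apply: (le_trans _ qn); rewrite /l.
  apply: (big_ind (fun l => (2 ^ l)%N%:R * Phi 1%N eps0 <= Phi (2 ^ N)%N (scale q))).
  - rewrite mul1r; apply: le_trans (c_le q) _; apply: Phi_incr => //.
    by rewrite expn_gt0.
  - by move=> a b ha hb; rewrite /maxn; case: ifP.
  - move=> j _; have /andP[h _] := Sspec j N.
    apply: le_trans (le_trans h _); first by rewrite ler_wpM2l.
    apply: Phi_decr; rewrite ?expn_gt0//.
    rewrite ler_pM2l// lef_pV2 ?posrE ?ltr0n// ler_nat ltnS.
    exact: ltnW.
split => //; exists rho.
  split; [exact: first_diff_semimetric| |exact: first_diff_generating|
    exact: first_diff_integrable].
  (* Admissibility is the upper bound at [n = 1], where the average is [rho] itself. *)
  move=> eps e0; have [delta d0 [C _ /(_ 1%N isT)]] := upper _ e0.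
  by rewrite averaged1 -EFinM => /le_lt_trans; apply; rewrite ltry.
split => // eps e0.
have [j jeps] : exists j, scale j <= eps.
  exists (Num.truncn (eps0 / eps)); rewrite ler_pdivrMr// mulrC -ler_pdivrMr//.
  exact/ltW/truncnS_gt.
have [delta d0 H] := odometer_entropy_ge R S j.
(* 32 is 8 from [odometer_entropy_ge], times 2 for passing from [n] to [2 ^ N], times 2 from
   [dyadic_profile]. *)
exists delta => //; exists (32 * Phi 1%N (scale j)).
  by rewrite mulr_gt0// (lt_le_trans c0).
move=> n n0; pose N := trunc_log 2 n.
have Nn : (2 ^ N <= n < 2 ^ N.+1)%N by exact: trunc_log_bounds.
have c1 : 0 <= 32 * Phi 1%N (scale j) by rewrite mulr_ge0// (le_trans (ltW c0)).
apply: le_trans (lee_wpmul2l _ (H n N Nn)); last by rewrite lee_fin.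
rewrite -EFinM lee_fin.
have /andP[_ h] := Sspec j N.
have h1 : Phi n eps <= Phi n (scale j) by exact: Phi_decr.
have h2 : Phi n (scale j) <= Phi (2 ^ N.+1)%N (scale j).
  by apply: Phi_incr => //; case/andP: Nn => _ /ltnW.
have h3 : Phi (2 ^ N.+1)%N (scale j) <= 2 * Phi (2 ^ N)%N (scale j).
  rewrite expnS; apply: (@subadditive_mul R (Phi^~ (scale j))) => //.
    by move=> k m k0 m0; exact: Phi_subadd.
  by rewrite expn_gt0.
have -> : forall p c : R, 32 * c * (p / 8) = 2 * (2 * p * c) by move=> p c; field.
by apply: le_trans (le_trans h1 (le_trans h2 h3)) _; rewrite ler_pM2l// ltW.
Qed.
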